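(* Let $f\in\mathcal B[x_1,\dots,x_n]$ be a polynomial over $\mathcal B$. The absolute polynomial $|f|\colon\mathcal B^n\to\mathbb R_{\ge0}$, $B\mapsto|f(B)|$, is finite piecewise polynomial along geodesics. The valuation polynomial $\mathrm{val}(f)\colon\mathcal H^n\to\mathbb R$, $B\mapsto\mathrm{val}(f(B))$, is piecewise linear (or a tropical polynomial) along geodesics.
   Context: $K$ is a field with a non-trivial valuation $\mathrm{val}\colon K\to\mathbb R\cup\{\infty\}$, complete with respect to the associated non-Archimedean absolute value $|a|=\exp(-\mathrm{val}(a))$ (base fixed). $\hat K$ is the completion of an algebraic closure of $K$, with the unique extensions of $\mathrm{val}$ and $|\cdot|$. For $a\in K^n$, $r\in\mathbb R_{\ge0}^n$, $v\in(\mathbb R\cup\{\infty\})^n$ put $B_{\mathcal B}(a,r)=\{z\in\hat K^n: |a_i-z_i|\le r_i\ \forall i\}$ and $B_{\mathcal H}(a,v)=\{z\in\hat K^n:\mathrm{val}(a_i-z_i)\ge v_i\ \forall i\}$. $\mathcal B^n$ is the set of all $B_{\mathcal B}(a,r)$ with $a\in K^n$, $r\in\mathbb R_{\ge 0}^n$, and $\mathcal H^n\subseteq\mathcal B^n$ is the subset of those with all $r_i>0$, equivalently the set of all $B_{\mathcal H}(a,v)$ with $a\in K^n$, $v\in\mathbb R^n$. Join on $\mathcal B^1$: $B_{\mathcal B}(a,r)\vee B_{\mathcal B}(a',r')$ is the union if one disc contains the other, and $B_{\mathcal B}(a,|a-a'|)$ otherwise. On $\mathcal B^1$, $d_{\mathcal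 B}(B_{\mathcal B}(a,r),B_{\mathcal B}(a',r'))=|r-r'|$ if one disc contains the other; on $\mathcal H^1$, $d_{\mathcal H}(B_{\mathcal H}(a,v),B_{\mathcal H}(a',v'))=|v-v'|$ if one contains the other. Otherwise the distance is $d_\bullet(B,B\vee B')+d_\bullet(B\vee B',B')$. On $\mathcal B^n$ and $\mathcal H^n$ one uses the $\ell^p$-metrics $d_{\mathcal B}^p(B,B')=(\sum_i d_{\mathcal B}(B_i,B_i')^p)^{1/p}$ and $d_{\mathcal H}^p(B,B')=(\sum_i d_{\mathcal H}(B_i,B_i')^p)^{1/p}$, where $B=B_1\times\dots\times B_n$, $B'=B_1'\times\dots\times B_n'$. A geodesic (of fixed speed $\lambda>0$) in a metric space $(X,d)$ is a map $\gamma\colon I\to X$ from a closed interval $I\subseteq\mathbb R$ with $d(\gamma(t),\gamma(t'))=\lambda|t-t'|$ for all $t,t'\in I$. Geodesics for $|f|$ are taken in $\mathcal B^n$ with its metric $d_{\mathcal B}^p$, geodesics for $\mathrm{val}(f)$ in $\mathcal H^n$ with its metric $d_{\mathcal H}^p$. A polynomial over $\mathcal B$ is a formal sum $f=\sum_{\alpha\in\mathbb Z_{\ge0}^n}C_\alpha x^\alpha$ with $C_\alpha\in\mathcal B^1$ and $C_\alpha=B_{\mathcal B}(0,0)$ for all but finitely many $\alpha$. For $B\in\mathcal B^n$, $|f(B)|=\sup_{c_\alpha\in C_\alpha,\,z\in B}\big|\sum_\alpha c_\alpha z^\alpha\big|$ and $\mathrm{val}(f(B))=\inf_{c_\alpha\in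 C_\alpha,\,z\in B}\mathrm{val}\big(\sum_\alpha c_\alpha z^\alpha\big)$.
   Formalization: The ℓ^p-metrics are taken with 1 < p < ∞, since for p = 1 and n ≥ 2 the claim fails (|x₁| along B(0,r(t))×B(0,t−r(t))); the claim about val(f) assumes f is not the zero polynomial, as val(0) = +∞ is not real. *)

(* Defs.v *)
(* MathComp / MathComp-Analysis *)
From HB Require Import structures.
From mathcomp Require Import all_boot all_order all_algebra.
From mathcomp Require Import all_classical all_reals all_analysis.

Set Implicit Arguments.
Unset Strict Implicit.
Unset Printing Implicit Defensive.

Import Order.TTheory GRing.Theory Num.Theory.
Import numFieldNormedType.Exports.

Local Open Scope classical_set_scope.
Local Open Scope ring_scope.

Section Valuations.
Variables (R : realType) (F : fieldType) (v : F -> \bar R).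

Record is_valuation : Prop := IsValuation {
  val_neqNy : forall x, v x <> -oo%E;
  val_eqy : forall x, v x = +oo%E <-> x = 0;
  val_mul : forall x y, v (x * y) = (v x + v y)%E;
  val_add : forall x y, (Order.min (v x) (v y) <= v (x + y))%E }.

Definition nontrivial_valuation : Prop :=
  is_valuation /\ exists2 x : F, x != 0 & v x <> 0%E.

(* [|x| = exp (- val x)], with [exp (- oo) = 0]; the value at [-oo] is junk. *)
Definition absv (x : F) : R := if v x is r%:E then expR (- r) else 0.

Definition valuation_complete : Prop :=
  forall u : nat -> F,
    (forall e : R, 0 < e -> exists N : nat, forall m k : nat,
       (N <= m)%N -> (N <= k)%N -> absv (u m - u k) < e) ->
    exists l : F, forall e : R, 0 < e -> exists N : nat, forall k : nat,
       (N <= k)%N -> absv (u k - l) < e.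

End Valuations.

(* [iota : K -> Khat] exhibits [(Khat, vhat)] as the completion of an algebraic
   closure [Kbar] of [K], with [vhat] extending [v]. *)
Definition completed_algebraic_closure (R : realType) (K Khat : fieldType)
    (v : K -> \bar R) (vhat : Khat -> \bar R)
    (iota : {rmorphism K -> Khat}) : Prop :=
  [/\ is_valuation vhat,
      forall x, vhat (iota x) = v x,
      valuation_complete vhat &
      exists (Kbar : closedFieldType) (i : {rmorphism K -> Kbar})
             (j : {rmorphism Kbar -> Khat}),
        [/\ forall x, iota x = j (i x),
            forall y, algebraicOver i y &
            forall (z : Khat) (e : R), 0 < e ->
              exists y : Kbar, absv vhat (z - j y) < e] ].

Section Discs.
Variables (R : realType) (K Khat : fieldType).
Variables (vhat : Khat -> \bar R) (iota : {rmorphism K -> Khat}).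

Definition discB (a : K) (r : R) : set Khat :=
  [set z | absv vhat (iota a - z) <= r].

Definition discH (a : K) (w : R) : set Khat :=
  [set z | (w%:E <= vhat (iota a - z))%E].

Definition B1 : set (set Khat) :=
  [set D | exists (a : K) (r : R), 0 <= r /\ D = discB a r].

Definition polydiscB n (a : 'I_n -> K) (r : 'I_n -> R) : set ('I_n -> Khat) :=
  [set z | forall i, absv vhat (iota (a i) - z i) <= r i].

Definition polydiscH n (a : 'I_n -> K) (w : 'I_n -> R) : set ('I_n -> Khat) :=
  [set z | forall i, ((w i)%:E <= vhat (iota (a i) - z i))%E].

Definition Bn n : set (set ('I_n -> Khat)) :=
  [set B | exists (a : 'I_n -> K) (r : 'I_n -> R),
     (forall i, 0 <= r i) /\ B = polydiscB a r].

Definition Hn n : set (set ('I_n -> Khat)) :=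
  [set B | exists (a : 'I_n -> K) (w : 'I_n -> R), B = polydiscH a w].

(* Discs are subsets of [Khat].  As the value group of [Khat] is dense in [R]
   when [v] is non-trivial, [radiusB D] is the only [r >= 0] with
   [D = discB a r] for some [a], and [radiusH D] the only [w] with
   [D = discH a w] for some [a]; the center is a choice. *)
Definition radiusB (D : set Khat) : R :=
  xget 0 [set r : R | 0 <= r /\ exists a : K, D = discB a r].

Definition radiusH (D : set Khat) : R :=
  xget 0 [set w : R | exists a : K, D = discH a w].

Definition center (D : set Khat) : K :=
  xget 0 [set a : K | exists2 r : R, 0 <= r & D = discB a r].

Definition nested (D D' : set Khat) : Prop := D `<=` D' \/ D' `<=` D.

(* For discs that are not nested this does not depend on the chosen centers. *)
Definition join (D D' : set Khat) : set Khat :=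
  if `[< nested D D' >] then D `|` D'
  else discB (center D)
             (absv vhat (iota (center D) - iota (center D'))).

Definition disc_dist (radius : set Khat -> R) (D D' : set Khat) : R :=
  if `[< nested D D' >] then `|radius D - radius D'|
  else `|radius D - radius (join D D')| + `|radius (join D D') - radius D'|.

Definition dB : set Khat -> set Khat -> R := disc_dist radiusB.
Definition dH : set Khat -> set Khat -> R := disc_dist radiusH.

(* The factor [B_i] of [B = B_1 x ... x B_n]. *)
Definition factor n (i : 'I_n) (B : set ('I_n -> Khat)) : set Khat :=
  [set z i | z in B].

Definition lp_dist n (d : set Khat -> set Khat -> R) (p : R)
    (B B' : set ('I_n -> Khat)) : R :=
  (\sum_(i < n) (d (factor i B) (factor i B')) `^ p) `^ p^-1.

Definition dBp n (p : R) := @lp_dist n dB p.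
Definition dHp n (p : R) := @lp_dist n dH p.

(* [f alpha] is the coefficient [C_alpha]; note [discB 0 0 = {0}]. *)
Definition polynomial_over_B n (f : {ffun 'I_n -> nat} -> set Khat) : Prop :=
  (forall alpha, B1 (f alpha)) /\
  finite_set [set alpha | f alpha <> discB 0 0].

Definition nonzero_polynomial n (f : {ffun 'I_n -> nat} -> set Khat) : Prop :=
  exists alpha, f alpha <> discB 0 0.

(* All the [sum_alpha c_alpha z^alpha] with [c_alpha] in [C_alpha] and [z] in
   [B]; the sum is finite because [c_alpha = 0] whenever [C_alpha = {0}]. *)
Definition poly_values n (f : {ffun 'I_n -> nat} -> set Khat)
    (B : set ('I_n -> Khat)) : set Khat :=
  [set y | exists (c : {ffun 'I_n -> nat} -> Khat) (z : 'I_n -> Khat),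
     [/\ forall alpha, f alpha (c alpha), B z &
         y = \sum_(alpha \in [set: {ffun 'I_n -> nat}])
               c alpha * \prod_(i < n) z i ^+ alpha i] ].

Definition abs_poly n (f : {ffun 'I_n -> nat} -> set Khat)
    (B : set ('I_n -> Khat)) : \bar R :=
  ereal_sup [set (absv vhat y)%:E | y in poly_values f B].

Definition val_poly n (f : {ffun 'I_n -> nat} -> set Khat)
    (B : set ('I_n -> Khat)) : \bar R :=
  ereal_inf [set vhat y | y in poly_values f B].

End Discs.

Section Geodesics.
Variables (R : realType).

Definition closed_interval (I : set R) : Prop := is_interval I /\ closed I.

Definition geodesic (T : Type) (X : set T) (d : T -> T -> R)
    (I : set R) (gamma : R -> T) : Prop :=
  [/\ closed_interval I,
      forall t, I t -> X (gamma t) &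
      exists2 lambda : R, 0 < lambda &
        forall t t', I t -> I t' ->
          d (gamma t) (gamma t') = lambda * `|t - t'| ].

(* The pieces are closed, so neighbouring polynomials agree at breakpoints. *)
Definition finite_piecewise (P : {poly R} -> Prop) (I : set R) (g : R -> R) :
    Prop :=
  exists (m : nat) (J : 'I_m -> set R) (q : 'I_m -> {poly R}),
    [/\ forall k, closed_interval (J k),
        I = \bigcup_k J k,
        forall k, P (q k) &
        forall k t, J k t -> g t = (q k).[t] ].

Definition finite_piecewise_polynomial : set R -> (R -> R) -> Prop :=
  finite_piecewise (fun=> True).

Definition finite_piecewise_linear : set R -> (R -> R) -> Prop :=
  finite_piecewise (fun q => (size q <= 2)%N).

End Geodesics.

(* Main.v *)
Require Import Defs.
From HB Require Import structures.
From mathcomp Require Import all_boot all_order all_algebra.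
From mathcomp Require Import all_classical all_reals all_analysis.
From mathcomp Require Import ring lra polyrcf.

(* By Taylor expansion at the centre [a], the value |f(B)| on a polydisc B with
   centre [a] and radius [r] is the maximum over beta of M_beta r^beta, where
   M_beta is the largest absolute value of the beta-th Taylor coefficient over
   all choices of coefficients of f.  So it suffices to cut a geodesic into
   finitely many pieces with a fixed centre and affine radii (affine logarithmic
   radii for the metric on H^n).

   By strict convexity of x^p the factors of an l^p-geodesic have constant speed,
   and each factor moves in a tree: the distance of two discs is 2 j - h - h',
   with [h] a height and [j] the height of the join, an ultrametric quantity.
   Hence each factor climbs and then descends, on either part the discs form a
   chain, and the chain has a common centre. *)

Set Implicit Arguments.
Unset Strict Implicit.
Unset Printing Implicit Defensive.

Import Order.TTheory GRing.Theory Num.Theory.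
Import numFieldNormedType.Exports.

Local Open Scope classical_set_scope.
Local Open Scope ring_scope.

(** * Finite piecewise polynomials *)

(** Strictness of the convexity is essential: for [p = 1] a geodesic could move one factor after the
    other, and its factors would not have constant speed.

    A common centre in [K] is not automatic either, since [K] need not be spherically complete: a
    chain of discs whose radii stay away from 0 may contain no common point. What helps is that
    heights are affine on closed pieces. Either a smallest disc occurs, and its centre works, or the
    heights are unbounded below, the radii tend to 0, and ordinary completeness suffices.

    Intervals may be unbounded, so the number of pieces is not bounded by compactness. It comes from
    two branches per factor and from the finitely many roots of differences of the competing
    polynomials.

    Both metrics are treated at once, through a height that is the radius or its logarithm. *)

Section ClosedIntervals.
Variable R : realType.
Implicit Types (I J L : set R) (g h : R -> R) (P : {poly R} -> Prop).

Lemma closed_intervalI I J :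
  closed_interval I -> closed_interval J -> closed_interval (I `&` J).
Proof.
move=> [iI cI] [iJ cJ]; split; last exact: closedI.
move=> x y [Ix Jx] [Iy Jy] z xzy; split; first exact: iI Ix Iy z xzy.
exact: iJ Jx Jy z xzy.
Qed.

Lemma closed_interval_bigcap (T : Type) (J : T -> set R) :
  (forall k, closed_interval (J k)) -> closed_interval (\bigcap_k J k).
Proof.
move=> cJ; split.
  move=> x y Jx Jy z xzy k _; have [iJk _] := cJ k.
  exact: iJk (Jx k Logic.I) (Jy k Logic.I) z xzy.
by apply: closed_bigI => k _; have [] := cJ k.
Qed.

Lemma closed_interval_le (x : R) : closed_interval [set t | t <= x].
Proof.
split; last exact: closed_le.
by move=> y z _ /= zx t /andP[_ tz]; apply: le_trans zx.
Qed.

Lemma closed_interval_ge (x : R) : closed_interval [set t | x <= t].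
Proof.
split; last exact: closed_ge.
by move=> y z /= xy _ t /andP[yt _]; apply: le_trans yt.
Qed.

Lemma finite_piecewise_fin (A : finType) P (J : A -> set R)
    (q : A -> {poly R}) I g :
    (forall k, closed_interval (J k)) -> I = \bigcup_k J k ->
    (forall k, P (q k)) -> (forall k t, J k t -> g t = (q k).[t]) ->
  finite_piecewise P I g.
Proof.
move=> cJ IJ Pq gq.
exists #|A|, (J \o enum_val), (q \o enum_val); split=> /=.
- by move=> k; apply: cJ.
- rewrite IJ; apply/seteqP; split=> t [k _ Jkt]; last by exists (enum_val k).
  by exists (enum_rank k) => //=; rewrite enum_rankK.
- by move=> k; apply: Pq.
- by move=> k t; apply: gq.
Qed.

Lemma finite_piecewise_bigcup (A : finType) P (J : A -> set R) I g :
    I = \bigcup_k J k -> (forall k, finite_piecewise P (J k) g) ->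
  finite_piecewise P I g.
Proof.
move=> IJ fJ.
have [m [L [q H]]] : exists (m : A -> nat) (L : forall k, 'I_(m k) -> set R)
    (q : forall k, 'I_(m k) -> {poly R}), forall k,
    [/\ forall l, closed_interval (L k l), J k = \bigcup_l L k l,
        forall l, P (q k l) & forall l t, L k l t -> g t = (q k l).[t]].
  exists (fun k => projT1 (cid (fJ k))).
  exists (fun k => projT1 (cid (projT2 (cid (fJ k))))).
  exists (fun k => projT1 (cid (projT2 (cid (projT2 (cid (fJ k))))))) => k.
  exact: (projT2 (cid (projT2 (cid (projT2 (cid (fJ k))))))).
apply: (@finite_piecewise_fin {k : A & 'I_(m k)} P
  (fun x => L (tag x) (tagged x)) (fun x => q (tag x) (tagged x))).
- by move=> [k l]; have [] := H k.
- rewrite IJ; apply/seteqP; split=> t.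
    move=> [k _]; have [_ -> _ _] := H k; case=> l _ Lt.
    by exists (Tagged (fun k => 'I_(m k)) l).
  by move=> [[k l] _ /= Lt]; exists k => //; have [_ -> _ _] := H k; exists l.
- by move=> [k l]; have [] := H k.
- by move=> [k l] t /=; have [_ _ _] := H k; apply.
Qed.

Lemma finite_piecewise_split P I g (x : R) :
    finite_piecewise P (I `&` [set t | t <= x]) g ->
    finite_piecewise P (I `&` [set t | x <= t]) g ->
  finite_piecewise P I g.
Proof.
move=> f1 f2; apply: (@finite_piecewise_bigcup bool P
  (fun b => I `&` (if b then [set t | t <= x] else [set t | x <= t]))).
  apply/seteqP; split=> t; last by move=> [b _ []].
  by move=> It; have [tx|/ltW xt] := leP t x; [exists true | exists false].
by case.
Qed.

(** Cutting at each point of [s] in turn. The pieces are closed, so a point of [s] may remain an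
    endpoint; hence the strict inequalities. *)
Lemma finite_piecewise_avoid P I g (s : seq R) :
    closed_interval I ->
    (forall L, closed_interval L -> L `<=` I ->
       (forall x a b, x \in s -> L a -> L b -> ~~ (a < x < b)) ->
       finite_piecewise P L g) ->
  finite_piecewise P I g.
Proof.
elim: s I => [|x s IH] I cI H; first exact: H.
apply: (@finite_piecewise_split _ _ _ x); apply: IH.
- exact: closed_intervalI cI (closed_interval_le x).
- move=> L cL LI Ls; apply: H => //; first by move=> t /LI[].
  move=> y a b; rewrite inE => /orP[/eqP-> La /LI[_ /= bx]|]; last exact: Ls.
  by apply/negP => /andP[_ /lt_geF]; rewrite bx.
- exact: closed_intervalI cI (closed_interval_ge x).
- move=> L cL LI Ls; apply: H => //; first by move=> t /LI[].
  move=> y a b; rewrite inE => /orP[/eqP-> /LI[_ /= ax] _|]; last exact: Ls.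
  by apply/negP => /andP[/lt_geF]; rewrite ax.
Qed.

(** The intermediate value theorem; endpoints of [L] may be roots. *)
Lemma no_root_constant_sign (p : {poly R}) L :
    (forall x a b, root p x -> L a -> L b -> ~~ (a < x < b)) ->
  (forall t, L t -> 0 <= p.[t]) \/ (forall t, L t -> p.[t] <= 0).
Proof.
move=> Lp; have [?|/existsNP[a /not_implyP[La /negP]]] :=
  pselect (forall t, L t -> 0 <= p.[t]); first by left.
rewrite -ltNge => pa; right=> b Lb; rewrite leNgt; apply/negP => pb.
wlog ab : a b p Lp La Lb pa pb / a <= b.
  move=> W; have [|/ltW ba] := leP a b; first by move/W; apply; eauto.
  apply: (W b a (- p)) => //; last 2 first.
  - by rewrite hornerN oppr_lt0.
  - by rewrite hornerN oppr_gt0.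
  by move=> x c d; rewrite rootN; apply: Lp.
have := @polyrcf.poly_ivtoo _ p a b ab.
rewrite nmulr_rlt0// => /(_ pb)[x]; rewrite in_itv/= => xab px.
by have := Lp x a b px La Lb; rewrite xab.
Qed.

(** Once [I] is cut at the roots of all differences, the family [qs] is totally ordered on each
    piece, so a single member is the maximum there. *)
Lemma finite_piecewise_max P I g (qs : seq {poly R}) :
    closed_interval I -> (forall q, q \in qs -> P q) ->
    (forall t, I t -> (exists2 q, q \in qs & g t = q.[t]) /\
       (forall q, q \in qs -> q.[t] <= g t)) ->
  finite_piecewise P I g.
Proof.
move=> cI Pqs gq.
pose s := flatten [seq rootsR (x.1 - x.2) | x <- [seq (x, y) | x <- qs, y <- qs]].
apply: (@finite_piecewise_avoid _ _ _ s) => // L cL LI Ls.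
have total p q : p \in qs -> q \in qs ->
    (forall t, L t -> p.[t] <= q.[t]) \/ (forall t, L t -> q.[t] <= p.[t]).
  move=> pqs qqs; have [->|pq] := eqVneq p q; first by left.
  have [|H|H] := @no_root_constant_sign (p - q) L.
  - move=> x a b rx La Lb; apply: Ls => //; apply/flattenP.
    exists (rootsR (p - q)); last by rewrite -roots_on_rootsR ?subr_eq0// in_itv.
    by apply/mapP; exists (p, q) => //; apply: allpairs_f.
  - by right=> t /H; rewrite hornerD hornerN subr_ge0.
  - by left=> t /H; rewrite hornerD hornerN subr_le0.
(* An empty [L] gets no piece at all: [qs] may be empty, and then no polynomial satisfying [P] is at
   hand. *)
have [[t0 Lt0]|L0] := pselect (exists t, L t); last first.
  apply: (@finite_piecewise_fin void _ (fun=> set0) (fun=> 0)) => //.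
  apply/seteqP; split=> t; last by case=> -[].
  by move=> Lt; case: L0; exists t.
have [q qqs qmax] : exists2 q, q \in qs &
    forall q', q' \in qs -> forall t, L t -> q'.[t] <= q.[t].
  have: qs != [::] by have [[q]] := gq _ (LI _ Lt0); case: (qs).
  (* The induction runs over lists contained in [qs], so that [total] stays applicable. *)
  have: {subset qs <= qs} by [].
  elim: {-2}qs => // p [_ sub _|p' r IH sub _].
    exists p; rewrite ?inE// => q'; rewrite inE => /eqP-> t _; exact: lexx.
  have [|//|q qr qmax] := IH; first by move=> x xr; apply: sub; rewrite in_cons xr orbT.
  have qqs : q \in qs by apply: sub; rewrite in_cons qr orbT.
  have [pq|qp] := total p q (sub _ (mem_head _ _)) qqs.
  - exists q; first by rewrite in_cons qr orbT.
    by move=> q'; rewrite in_cons => /orP[/eqP->|]; [apply: pq|apply: qmax].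
  - exists p; first by rewrite mem_head.
    move=> q'; rewrite in_cons => /orP[/eqP-> t _|]; first exact: lexx.
    by move=> /qmax qq' t Lt; apply: le_trans (qq' t Lt) (qp t Lt).
apply: (@finite_piecewise_fin unit _ (fun=> L) (fun=> q)) => //.
- by apply/seteqP; split=> t; [exists tt | case].
- by move=> _; apply: Pqs.
move=> _ t Lt; have [[q' q'qs gt] ub] := gq t (LI t Lt).
by apply/eqP; rewrite eq_le ub// andbT gt qmax.
Qed.

Lemma finite_piecewiseN P I g : (forall q, P q -> P (- q)) ->
  finite_piecewise P I (fun t => - g t) -> finite_piecewise P I g.
Proof.
move=> PN [m [J [q [cJ IJ Pq gq]]]]; exists m, J, (fun k => - q k); split=> //.
  by move=> k; apply: PN.
by move=> k t /gq; rewrite hornerN => <-; rewrite opprK.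
Qed.

(** Applied to heights: the alternative is between a smallest disc and radii tending to the
    bottom. *)
Lemma affine_min_or_unbounded L g (c d : R) : closed_interval L ->
    (exists t, L t) -> (forall t, L t -> g t = c + d * t) ->
  (exists2 t0, L t0 & forall t, L t -> g t0 <= g t) \/
  (forall x, exists2 t, L t & g t < x).
Proof.
move=> [_ cL] [t1 Lt1] gL.
have [lb|nlb] := pselect (has_lbound [set g t | t in L]); last first.
  right=> x; apply: contrapT => H; apply: nlb; exists x.
  by move=> _ [t Lt <-]; rewrite leNgt; apply/negP => gtx; apply: H; exists t.
left; have [d0|d0] := eqVneq d 0.
  by exists t1 => // t Lt; rewrite !gL// d0 !mul0r.
have hi : has_inf [set g t | t in L] by split=> //; exists (g t1), t1.
set m := inf [set g t | t in L].
(* The point where the affine function takes the value [m]. Its distance to [t] is (g t - m) / |d|,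
   so values close to the infimum are taken close to it, and [L] is closed. *)
have Lt0 : L ((m - c) / d).
  apply: cL => B /nbhs_ballP[e /= e0 eB].
  have de : 0 < e * `|d| by rewrite mulr_gt0// normr_gt0.
  have [_ [t Lt <-] gtm] := inf_adherent de hi.
  exists t; split=> //; apply: eB; rewrite /ball/=.
  have -> : (m - c) / d - t = (m - g t) / d by rewrite gL//; field.
  rewrite normrM normfV ltr_pdivrMr ?normr_gt0// ler0_norm; last first.
    by rewrite subr_le0; apply: ge_inf => //; exists t.
  by rewrite opprB ltrBlDl.
exists ((m - c) / d) => // t Lt; rewrite (gL _ Lt0).
by rewrite mulrCA divff// mulr1 subrKC; apply: ge_inf => //; exists t.
Qed.

End ClosedIntervals.

(** * Strict convexity and geodesics in products *)

Section StrictConvexity.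
Variable R : realType.
Implicit Types (p x y t : R).

(* Weighted AM-GM for [y `^ p] and [1], from [expR x > 1 + x]. *)
Lemma powR_gt_tangent1 p y : 1 < p -> 0 <= y -> y != 1 ->
  1 + p * (y - 1) < y `^ p.
Proof.
move=> p1 y0 y1; have p0 : 0 < p by lra.
have [->|yn0] := eqVneq y 0; first by rewrite powR0 ?gt_eqF//; lra.
have {yn0}y0 : 0 < y by rewrite lt_neqAle eq_sym yn0.
set a := y `^ p; have a0 : 0 < a by apply: powR_gt0.
(* [m] is the arithmetic mean of [a] and 1 with weights 1/p and 1 - 1/p, and [y] is their geometric
   mean; the claim amounts to [y < m]. *)
set m := 1 + (a - 1) / p; have m0 : 0 < m.
  have -> : m = (a + (p - 1)) / p by rewrite /m; field; rewrite gt_eqF.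
  by apply: divr_gt0 => //; lra.
have a1 : a != 1.
  apply: contra y1 => /eqP a1; have : ln a = 0 by rewrite a1 ln1.
  rewrite ln_powR => /eqP; rewrite mulf_eq0 gt_eqF//= => /eqP lny.
  by rewrite -(lnK y0) lny expR0.
have lnm (x : R) : 0 < x -> x != m -> ln x - ln m < x / m - 1.
  move=> x0 xm; rewrite -ln_div ?posrE//.
  have : ln (x / m) != 0.
    rewrite -ln1; apply: contra xm => /eqP/ln_inj; rewrite !posrE.
    by move=> /(_ (divr_gt0 x0 m0) ltr01) /divr1_eq ->.
  move/expR_gt1Dx; rewrite lnK ?posrE ?divr_gt0//; lra.
have am : a != m.
  apply: contra a1 => /eqP am; have : (a - 1) * (p - 1) = 0.
    have : a * p = m * p by rewrite -am.
    rewrite /m mulrDl divfK ?gt_eqF//; lra.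
  by move=> /eqP; rewrite mulf_eq0 !subr_eq0 (gt_eqF p1) orbF.
have m1 : 1 != m.
  apply: contra a1 => /eqP; rewrite /m -[X in X = _]addr0 => /addrI/esym/eqP.
  by rewrite mulf_eq0 invr_eq0 (gt_eqF p0) orbF subr_eq0.
have la := lnm _ a0 am; have l1 := lnm _ ltr01 m1.
have lay : ln a = p * ln y by rewrite ln_powR.
have ym : y < m.
  rewrite -ltr_ln ?posrE// -subr_gt0.
  (* The weighted deviations from the mean cancel, so adding the two logarithmic bounds leaves only
     ln y < ln m. *)
  have e : a / m - 1 + (p - 1) * (1 / m - 1) = 0.
    have -> : a = p * m - (p - 1) by rewrite /m; field; rewrite gt_eqF.
    by field; rewrite gt_eqF.
  have : (p - 1) * (ln 1 - ln m) < (p - 1) * (1 / m - 1).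
    by rewrite ltr_pM2l// subr_gt0.
  rewrite ln1 => l1'; have : p * (ln y - ln m) < 0 by nra.
  by rewrite pmulr_rlt0// subr_lt0 subr_gt0.
have : p * (y - 1) < p * (m - 1) by rewrite ltr_pM2l//; lra.
by rewrite /m addrAC subrr add0r mulrCA divff ?gt_eqF// mulr1; lra.
Qed.

(** By homogeneity, division by [x] reduces this to the tangent at 1. The slope is the derivative p
    x^(p-1), written with a division. *)
Lemma powR_ge_tangent p x y : 1 < p -> 0 < x -> 0 <= y ->
  x `^ p + p * x `^ p / x * (y - x) <= y `^ p ?= iff (y == x).
Proof.
move=> p1 x0 y0; have [->|yx] := eqVneq y x.
  by split; rewrite subrr mulr0 addr0 // eqxx.
suff lt : x `^ p + p * x `^ p / x * (y - x) < y `^ p.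
  by split; [exact: ltW|rewrite lt_eqF].
have yx1 : y / x != 1.
  by apply: contra yx => /eqP/divr1_eq ->.
have := powR_gt_tangent1 p1 (divr_ge0 y0 (ltW x0)) yx1.
have -> : y `^ p = (y / x) `^ p * x `^ p.
  by rewrite -powRM ?divr_ge0 ?(ltW x0)// divfK// gt_eqF.
rewrite -(ltr_pM2r (powR_gt0 p x0)).
suff -> : (1 + p * (y / x - 1)) * x `^ p = x `^ p + p * x `^ p / x * (y - x) by [].
by field; rewrite gt_eqF.
Qed.

(** Average the tangent inequalities at the mean [m]: the linear terms cancel, and equality forces
    both points to be [m]. *)
Lemma powR_strictly_convex p x y t : 1 < p -> 0 < t < 1 -> 0 <= x -> 0 <= y ->
  (t * x + (1 - t) * y) `^ p <= t * x `^ p + (1 - t) * y `^ p ?= iff (x == y).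
Proof.
move=> p1 /andP[t0 t1] x0 y0; set m := t * x + (1 - t) * y.
have p0 : p != 0 by rewrite gt_eqF//; lra.
(* The tangent bound needs a positive base point; a zero mean forces [x] and [y] to vanish. *)
have [m0|m0] := leP m 0.
  have tx : 0 <= t * x by rewrite mulr_ge0// ltW.
  have ty : 0 <= (1 - t) * y by rewrite mulr_ge0// subr_ge0 ltW.
  have /eqP : t * x = 0 by move: m0; rewrite /m; lra.
  rewrite mulf_eq0 (gt_eqF t0)/= => /eqP ->.
  have /eqP : (1 - t) * y = 0 by move: m0; rewrite /m; lra.
  rewrite mulf_eq0 subr_eq0 (gt_eqF t1)/= => /eqP ->.
  have -> : m = 0 by apply/eqP; rewrite eq_le m0 addr_ge0.
  by split; rewrite powR0// !mulr0 addr0 ?eqxx.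
have [lx ex] := powR_ge_tangent p1 m0 x0.
have [ly ey] := powR_ge_tangent p1 m0 y0.
have e : t * (m `^ p + p * m `^ p / m * (x - m)) +
         (1 - t) * (m `^ p + p * m `^ p / m * (y - m)) = m `^ p.
  transitivity (m `^ p + p * m `^ p / m * (t * x + (1 - t) * y - m)).
    by ring.
  by rewrite -/m subrr mulr0 addr0.
have t1' : 0 < 1 - t by lra.
split.
  by rewrite -{1}e lerD// ler_pM2l.
apply/eqP/eqP => [E|xy]; last by rewrite /m xy -mulrDl subrKC mul1r; lra.
have lx' : t * (m `^ p + p * m `^ p / m * (x - m)) <= t * x `^ p by rewrite ler_pM2l.
have ly' : (1 - t) * (m `^ p + p * m `^ p / m * (y - m)) <= (1 - t) * y `^ p.
  by rewrite ler_pM2l.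
have ex' : m `^ p + p * m `^ p / m * (x - m) = x `^ p.
  by apply: (mulfI (lt0r_neq0 t0)); lra.
have ey' : m `^ p + p * m `^ p / m * (y - m) = y `^ p.
  by apply: (mulfI (lt0r_neq0 t1')); lra.
by move/eqP: ex'; move/eqP: ey'; rewrite ex ey => /eqP -> /eqP ->.
Qed.

(* Equality in Minkowski's inequality forces proportional components, so a
   geodesic of the l^p-product is a product of geodesics. *)
Lemma lp_geodesic_components (n : nat) p (I : set R) (lambda : R)
    (e : 'I_n -> R -> R -> R) :
    1 < p -> 0 <= lambda ->
    (forall i s t, I s -> I t -> 0 <= e i s t) ->
    (forall i s t, I s -> I t -> e i s t = e i t s) ->
    (forall i s, I s -> e i s s = 0) ->
    (forall i s t u, I s -> I t -> I u -> e i s u <= e i s t + e i t u) ->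
    (forall s t, I s -> I t ->
       (\sum_i (e i s t) `^ p) `^ p^-1 = lambda * `|s - t|) ->
  forall i, exists l, forall s t, I s -> I t -> e i s t = l * `|s - t|.
Proof.
move=> p1 l0 e0 eC exx eT eL.
have pn0 : p != 0 by rewrite gt_eqF//; lra.
have slope s t : I s -> I t -> s < t ->
    \sum_i (e i s t / (t - s)) `^ p = lambda `^ p.
  move=> Is It st; have ts : 0 < t - s by rewrite subr_gt0.
  have := eL s t Is It; rewrite distrC gtr0_norm// => /(congr1 (@powR R ^~ p)).
  rewrite -powRrM mulVf// powRr1; last by apply: sumr_ge0 => i _; apply: powR_ge0.
  rewrite powRM ?(ltW ts)// => H.
  have -> : \sum_i (e i s t / (t - s)) `^ p = (\sum_i (e i s t) `^ p) * (t - s)^-1 `^ p.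
    rewrite mulr_suml; apply: eq_bigr => i _.
    by rewrite powRM ?e0// invr_ge0 ltW.
  rewrite H -mulrA -powRM ?invr_ge0 ?(ltW ts)// divff ?gt_eqF// powR1 ?mulr1//.
have key s t u i : I s -> I t -> I u -> s < t -> t < u ->
    e i s t / (t - s) = e i s u / (u - s) /\ e i t u / (u - t) = e i s u / (u - s).
  move=> Is It Iu st tu; have su := lt_trans st tu.
  have ts : 0 < t - s by rewrite subr_gt0.
  have ut : 0 < u - t by rewrite subr_gt0.
  have us : 0 < u - s by rewrite subr_gt0.
  (* With this weight the mean of the two quotients [X] and [Y] is (e s t + e t u) / (u - s), which
     the triangle inequality compares with [Z]. *)
  set th := (t - s) / (u - s).
  have th0 : 0 < th by rewrite divr_gt0.
  have th1 : th < 1 by rewrite ltr_pdivrMr// mul1r; lra.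
  pose X i := e i s t / (t - s); pose Y i := e i t u / (u - t).
  pose Z i := e i s u / (u - s).
  have X0 j : 0 <= X j by rewrite divr_ge0 ?e0// ltW.
  have Y0 j : 0 <= Y j by rewrite divr_ge0 ?e0// ltW.
  have Z0 j : 0 <= Z j by rewrite divr_ge0 ?e0// ltW.
  pose W j := th * X j + (1 - th) * Y j.
  have ZW j : Z j <= W j.
    have -> : W j = (e j s t + e j t u) / (u - s).
      by rewrite /W /th /X /Y; field; rewrite !gt_eqF.
    by rewrite ler_pM2r ?invr_gt0// eT.
  have th01 : 0 < th < 1 by rewrite th0.
  have cv j := powR_strictly_convex p1 th01 (X0 j) (Y0 j).
  have ZWp j : Z j `^ p <= W j `^ p.
    by apply: ge0_ler_powR; rewrite ?nnegrE//; [lra|apply: le_trans (ZW j)].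
  (* By [slope] the three families have the same sum of p-th powers. The summands are nonnegative,
     so convexity and the triangle inequality are equalities in every component. *)
  have sum0 : \sum_j (th * X j `^ p + (1 - th) * Y j `^ p - Z j `^ p) = 0.
    rewrite sumrB big_split/= -!mulr_sumr.
    by rewrite (slope s t)// (slope t u)// (slope s u)//; ring.
  have all0 j : th * X j `^ p + (1 - th) * Y j `^ p - Z j `^ p = 0.
    have /eqP := sum0; rewrite psumr_eq0; last first.
      move=> k _; rewrite subr_ge0; apply: le_trans (ZWp k) _; exact: (cv k).1.
    by move=> /allP/(_ j); rewrite mem_index_enum => /(_ isT)/eqP.
  have := all0 i; have [c1 c2] := cv i; have := ZWp i => zw Ei.
  have XY : X i = Y i.
    by apply/eqP; rewrite -c2 eq_le c1/=; move: zw; rewrite /W; lra.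
  have ZX : Z i = X i.
    have : Z i `^ p = X i `^ p by move: Ei; rewrite -XY; lra.
    move=> /(congr1 (@powR R ^~ p^-1)); by rewrite -!powRrM mulfV// !powRr1.
  by rewrite -/(X i) -/(Y i) -/(Z i) -XY ZX.
move=> i.
(* Two arbitrary pairs of times are compared through an interval that contains both. *)
have key' m s t M : I m -> I s -> I t -> I M -> m <= s -> s < t -> t <= M ->
    e i s t / (t - s) = e i m M / (M - m).
  move=> Im Is It IM; rewrite le_eqVlt => /predU1P[->|ms] st.
    by rewrite le_eqVlt => /predU1P[->//|tM]; have [] := key s t M i Is It IM st tM.
  have [_ Em] := key m s t i Im Is It ms st; rewrite Em.
  rewrite le_eqVlt => /predU1P[->//|tM].
  by have [] := key m t M i Im It IM (lt_trans ms st) tM.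
have [[s0 [t0 [Is0 It0 st0]]]|H] :=
  pselect (exists s t, [/\ I s, I t & s < t]); last first.
  exists 0 => s t Is It; rewrite mul0r; have [st|ts|->] := ltgtP s t.
  - by case: H; exists s, t.
  - by case: H; exists t, s.
  - exact: exx.
exists (e i s0 t0 / (t0 - s0)) => s t Is It.
wlog st : s t Is It / s < t.
  move=> W; have [|ts|->] := ltgtP s t; first exact: W.
  - by rewrite eC// distrC; apply: W.
  - by rewrite exx// subrr normr0 mulr0.
have Imin : I (Num.min s s0) by rewrite /Num.min; case: ifP.
have Imax : I (Num.max t t0) by rewrite /Num.max; case: ifP.
rewrite (key' _ s0 t0 _ Imin Is0 It0 Imax) ?ge_min ?le_max ?lexx ?orbT//.
rewrite -(key' _ s t _ Imin Is It Imax) ?ge_min ?le_max ?lexx ?orbT//.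
by rewrite distrC gtr0_norm ?subr_gt0// divfK// subr_eq0 gt_eqF.
Qed.

End StrictConvexity.

(** * Geodesics in trees *)

Section TreeGeodesic.
Variable R : realType.

(* [h] is the height of a moving point of a rooted tree, [j s t] the height of
   the join of the points at times [s] and [t].  For s < t < u additivity of the
   distance gives j s u = j s t + j t u - h t, while j s u is at most one of
   the two terms; so the other one is [h t].  Hence the point goes up, then
   down. *)
Lemma tree_geodesic_pieces (I : set R) (lambda : R) (j : R -> R -> R)
    (h : R -> R) :
    closed_interval I ->
    (forall s t, I s -> I t -> j s t = j t s) ->
    (forall s t, I s -> I t -> h s <= j s t) ->
    (forall s t u, I s -> I t -> I u -> j s u <= Num.max (j s t) (j t u)) ->
    (forall s t, I s -> I t -> 2 * j s t - h s - h t = lambda * `|s - t|) ->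
  exists (J : bool -> set R) (c d : bool -> R),
    [/\ forall k, closed_interval (J k),
        I = \bigcup_k J k,
        forall k t, J k t -> h t = c k + d k * t &
        forall k s t, J k s -> J k t -> j s t <= Num.max (h s) (h t)].
Proof.
move=> cI jC hj jU jd; pose sg (k : bool) : R := if k then 1 else - 1.
(* [sg] orients time: [J true] holds the times up to which the height has only risen at speed
   [lambda], [J false] those from which it only falls. *)
pose J k := [set t | I t /\ forall s, I s -> sg k * s <= sg k * t ->
                            h t - h s = lambda * sg k * (t - s)].
have sg2 k : sg k * sg k = 1 by case: k; rewrite /sg; lra.
have absE k s t : sg k * s <= sg k * t -> `|s - t| = sg k * (t - s).
  case: k; rewrite /sg ?mul1r ?mulN1r => st.
    by rewrite distrC ger0_norm ?subr_ge0.
  by rewrite ger0_norm ?opprB// subr_ge0 -lerN2.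
have down k s t : J k t -> I s -> sg k * s <= sg k * t -> J k s.
  move=> [It Jt] Is st; split=> // r Ir rs.
  have := Jt r Ir (le_trans rs st); have := Jt s Is st; lra.
have jh k s t : J k t -> I s -> sg k * s <= sg k * t -> j s t = h t.
  move=> [It Jt] Is st; have := jd s t Is It; rewrite (absE _ _ _ st).
  by have := Jt s Is st; lra.
have sgT k s t : sg k * s <= sg k * t \/ sg k * t <= sg k * s.
  by have [|/ltW] := leP (sg k * s) (sg k * t); [left|right].
have aff k : exists c d, forall t, J k t -> h t = c + d * t.
  have [[t1 Jt1]|N] := pselect (exists t, J k t); last first.
    by exists 0, 0 => t Jt; case: N; exists t.
  exists (h t1 - lambda * sg k * t1), (lambda * sg k) => t Jt.
  have [It H] := Jt; have [It1 H1] := Jt1.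
  by have [le|le] := sgT k t t1; [have := H1 t It le|have := H t1 It1 le]; lra.
have [c /choice[d Jcd]] := choice aff.
exists J, c, d; split=> //.
- move=> k; split.
    move=> x y Jx Jy z /andP[xz zy]; have [iI _] := cI.
    have Iz : I z by apply: (iI x y) => //; [case: Jx|case: Jy|rewrite xz].
    case: k Jx Jy => Jx Jy.
      by apply: (down true z y) => //; rewrite /sg !mul1r.
    by apply: (down false z x) => //; rewrite /sg !mulN1r lerN2.
  (* Closedness: the height is Lipschitz with constant [lambda], so the identity defining [J k]
     passes from nearby points to [t]. *)
  move=> t clt.
  have It : I t.
    by case: cI => _; apply; move=> B /clt[x [[Ix _] Bx]]; exists x.
  split=> // s Is st.
  have [[t' [Jt' tt']]|N] := pselect (exists t', J k t' /\ sg k * t <= sg k * t').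
    by have [_] := down k t t' Jt' It tt'; apply.
  have hL x : I x -> `|h t - h x| <= lambda * `|x - t|.
    move=> Ix; have := jd x t Ix It; have := hj x t Ix It; have := hj t x It Ix.
    rewrite (jC t x)// ler_norml; lra.
  have [->|nst] := eqVneq s t; first by rewrite !subrr mulr0.
  have l0 : 0 <= lambda.
    have := hL s Is; have : 0 < `|s - t| by rewrite normr_gt0 subr_eq0.
    move=> p0 le; have := le_trans (normr_ge0 _) le; rewrite pmulr_lge0//.
  apply/eqP; rewrite -subr_eq0 -normr_le0; apply/ler_addgt0Pl => e e0.
  rewrite addr0.
  (* The first bound keeps [s] behind the approximating point [x] in the chosen orientation; the
     second keeps the error, at most 2 lambda |t - x|, below [e]. *)
  pose d0 := Num.min `|s - t| (e / (2 * lambda + 1)).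
  have d00 : 0 < d0.
    by rewrite lt_min normr_gt0 subr_eq0 nst divr_gt0//; lra.
  have [x [Jx /= xt]] := clt _ (nbhsx_ballx t d0 d00).
  have {}xt : `|t - x| < d0 by exact: xt.
  have [Ix Hx] := Jx.
  have sx : sg k * s <= sg k * x.
    have [//|xs] := sgT k s x.
    have : `|t - x| < `|s - t| by apply: lt_le_trans xt _; rewrite ge_min lexx.
    rewrite (absE _ _ _ st) distrC (absE k); last exact: le_trans xs st.
    have : sg k * (x - s) <= 0 by rewrite mulrBr; lra.
    by rewrite !mulrBr; lra.
  have xt' : `|t - x| <= e / (2 * lambda + 1).
    by apply: ltW; apply: lt_le_trans xt _; rewrite ge_min lexx orbT.
  have -> : h t - h s - lambda * sg k * (t - s) =
      (h t - h x) - lambda * sg k * (t - x) by have := Hx s Is sx; lra.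
  apply: le_trans (ler_normB _ _) _.
  have : `|lambda * sg k * (t - x)| <= lambda * `|t - x|.
    rewrite !normrM (ger0_norm l0).
    have -> : `|sg k| = 1 by case: (k); rewrite /sg ?normrN ?normr1.
    by rewrite mulr1.
  have := hL x Ix; rewrite distrC (distrC x t).
  move: xt'; rewrite ler_pdivlMr; last by lra.
  have := normr_ge0 (t - x); lra.
- apply/seteqP; split=> [t It|t [k _ []]//].
  have [Jt|N] := pselect (J true t); first by exists true.
  exists false => //; split=> // u Iu; rewrite /sg !mulN1r lerN2 => tu.
  (* Outside the rising part some earlier [s] has its join with [t] strictly above [t]. Then it must
     be [j t u] that equals [h t], for every later [u]. *)
  have : exists s, [/\ I s, s <= t & h t < j s t].
    apply: contrapT => H; apply: N; split=> // s Is; rewrite /sg !mul1r => st.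
    have : ~ (h t < j s t) by move=> K; apply: H; exists s.
    move=> /negP; rewrite -leNgt => jle.
    have := jd s t Is It; have := hj t s It Is; rewrite (jC t s)//.
    by rewrite distrC ger0_norm ?subr_ge0//; lra.
  move=> [s [Is st hjs]].
  have := jd s t Is It; have := jd t u It Iu; have := jd s u Is Iu.
  rewrite (distrC s t) (distrC s u) (distrC t u) !ger0_norm ?subr_ge0//; last exact: le_trans tu.
  have := hj t u It Iu; have := jU s t u Is It Iu.
  by rewrite le_max => /orP[]; lra.
- move=> k s t Js Jt; have [It _] := Jt; have [Is _] := Js.
  have [le|le] := sgT k s t; first by rewrite (jh k s t)// le_max lexx orbT.
  by rewrite jC// (jh k t s)// le_max lexx.
Qed.

End TreeGeodesic.

(** * Absolute values and the Gauss norm *)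

Section AbsoluteValue.
Variables (R : realType) (F : fieldType) (v : F -> \bar R).
Hypothesis vV : is_valuation v.
Local Notation N := (absv v).

Lemma absv_ge0 x : 0 <= N x.
Proof. by rewrite /absv; case: (v x) => // r; apply: expR_ge0. Qed.

Lemma absv_eq0 x : (N x == 0) = (x == 0).
Proof.
apply/idP/eqP => [|->]; last by rewrite /absv (val_eqy vV 0).2.
have := val_neqNy vV (x:=x); have := val_eqy vV x; rewrite /absv.
case: (v x) => [r _ _|[H _] _ _|_ //]; last exact: H.
by rewrite (gt_eqF (expR_gt0 _)).
Qed.

Lemma absv0 : N 0 = 0. Proof. by apply/eqP; rewrite absv_eq0. Qed.

Lemma absv_gt0 x : (0 < N x) = (x != 0).
Proof. by rewrite lt_neqAle absv_ge0 andbT eq_sym absv_eq0. Qed.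

Lemma val_fin x : x != 0 -> v x = (- ln (N x))%:E.
Proof.
move=> x0; have := val_neqNy vV (x:=x); have := (val_eqy vV x).1; rewrite /absv.
case: (v x) => [r _ _|H _|_ //]; first by rewrite expRK opprK.
by move/eqP: x0; rewrite H.
Qed.

Lemma absvM x y : N (x * y) = N x * N y.
Proof.
have [->|x0] := eqVneq x 0; first by rewrite !mul0r absv0 mul0r.
have [->|y0] := eqVneq y 0; first by rewrite !mulr0 absv0 mulr0.
rewrite {1}/absv (val_mul vV) !val_fin// -EFinD -opprD opprK expRD.
by rewrite !lnK// posrE absv_gt0.
Qed.

Lemma absv1 : N 1 = 1.
Proof.
have /eqP : N 1 * N 1 = N 1 * 1 by rewrite -absvM !mulr1.
by rewrite -subr_eq0 -mulrBr mulf_eq0 absv_eq0 oner_eq0/= subr_eq0 => /eqP.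
Qed.

Lemma absvX x n : N (x ^+ n) = N x ^+ n.
Proof. by elim: n => [|n IH]; rewrite ?expr0 ?absv1// !exprS absvM IH. Qed.

Lemma absv_prod (I : Type) (s : seq I) (P : pred I) (G : I -> F) :
  N (\prod_(i <- s | P i) G i) = \prod_(i <- s | P i) N (G i).
Proof. exact: (big_morph N absvM absv1). Qed.

Lemma absvV x : N x^-1 = (N x)^-1.
Proof.
have [->|x0] := eqVneq x 0; first by rewrite !invr0 absv0 invr0.
have nx0 : N x != 0 by rewrite absv_eq0.
by apply: (mulfI nx0); rewrite -absvM !divff// absv1.
Qed.

Lemma absvN x : N (- x) = N x.
Proof.
suff e : N (-1) = 1 by rewrite -mulN1r absvM e mul1r.
have : N (-1) ^+ 2 = 1 by rewrite -absvX sqrrN expr1n absv1.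
by move=> /eqP; rewrite sqrf_eq1 => /orP[/eqP//|/eqP e]; have := absv_ge0 (-1); rewrite e; lra.
Qed.

Lemma absv_distC x y : N (x - y) = N (y - x).
Proof. by rewrite -absvN opprB. Qed.

Lemma absvD_le x y c : N x <= c -> N y <= c -> N (x + y) <= c.
Proof.
have [->|x0] := eqVneq x 0; first by rewrite add0r.
have [->|y0] := eqVneq y 0; first by rewrite addr0.
have [->|xy0] := eqVneq (x + y) 0.
  by rewrite absv0 => xc _; apply: le_trans xc; apply: absv_ge0.
have := val_add vV x y; rewrite !val_fin// ge_min !lee_fin !lerN2.
by move=> /orP[]; rewrite ler_ln ?posrE ?absv_gt0// => le xc yc;
  apply: le_trans le _.
Qed.

Lemma absvB_le x y c : N x <= c -> N y <= c -> N (x - y) <= c.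
Proof. by move=> xc yc; apply: absvD_le; rewrite ?absvN. Qed.

Lemma absvD_lt x y c : N x < c -> N y < c -> N (x + y) < c.
Proof.
move=> xc yc; apply: (@le_lt_trans _ _ (Num.max (N x) (N y))).
  by apply: absvD_le; rewrite le_max lexx ?orbT.
by rewrite gt_max xc.
Qed.

Lemma absv_sum_le (I : Type) (s : seq I) (P : pred I) (G : I -> F) c :
  0 <= c -> (forall i, P i -> N (G i) <= c) -> N (\sum_(i <- s | P i) G i) <= c.
Proof.
move=> c0 H; elim/big_rec: _ => [|i x Pi xc]; first by rewrite absv0.
by apply: absvD_le => //; apply: H.
Qed.

Lemma absv_sum_lt (I : Type) (s : seq I) (P : pred I) (G : I -> F) c :
  0 < c -> (forall i, P i -> N (G i) < c) -> N (\sum_(i <- s | P i) G i) < c.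
Proof.
move=> c0 H; elim/big_rec: _ => [|i x Pi xc]; first by rewrite absv0.
by apply: absvD_lt => //; apply: H.
Qed.

Lemma absvD_dominant x y : N y < N x -> N (x + y) = N x.
Proof.
move=> yx; apply/eqP; rewrite eq_le absvD_le ?(ltW yx)//=.
rewrite leNgt; apply/negP => lt; have : N (x + y - y) < N x.
  by apply: absvD_lt; rewrite ?absvN.
by rewrite addrK ltxx.
Qed.

(** The largest term strictly dominates all others, so no cancellation can occur. *)
Lemma le_absv_sum_distinct (T : finType) (x : T -> F) (t : T) :
    (forall t t', x t != 0 -> t != t' -> N (x t) != N (x t')) ->
  N (x t) <= N (\sum_t x t).
Proof.
move=> dist.
case: (@arg_maxP _ _ _ t xpredT (fun t => N (x t)) isT) => u _ umax.
have {}umax w : N (x w) <= N (x u) by apply: umax.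
apply: le_trans (umax t) _.
have [->|xu0] := eqVneq (x u) 0; first by rewrite absv0 absv_ge0.
rewrite (bigD1 u)//= absvD_dominant//; apply: absv_sum_lt; first by rewrite absv_gt0.
by move=> w wu; rewrite lt_neqAle umax// andbT eq_sym dist// eq_sym.
Qed.

End AbsoluteValue.

(* Only values are perturbed: a generic [y] of absolute value slightly below 1
   separates the absolute values of the monomials, so neither the residue field
   nor an algebraic closure enters. *)
Section GaussNorm.
Variables (R : realType) (F : fieldType) (v : F -> \bar R).
Hypothesis vV : is_valuation v.
Local Notation N := (absv v).
Hypothesis dense_values : forall a b : R, 0 <= a -> a < b ->
  exists x, a < N x < b.

Lemma dense_values_avoid (s : seq R) (a b : R) : 0 <= a -> a < b ->
  exists2 x, a < N x < b & N x \notin s.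
Proof.
elim: s a b => [|y s IH] a b a0 ab.
  by have [x xab] := dense_values a0 ab; exists x.
have [ay|ya] := ltP a y; last first.
  have [x /andP[ax xb] xs] := IH a b a0 ab; exists x; first by rewrite ax.
  by rewrite inE negb_or xs gt_eqF// (le_lt_trans ya).
have [|x /andP[ax]] := IH a (Num.min y b) a0; first by rewrite lt_min ay.
rewrite lt_min => /andP[xy xb] xs; exists x; first by rewrite ax.
by rewrite inE negb_or xs lt_eqF.
Qed.

(** Let [th] tend to 1. This absorbs the loss from approximating a radius by values of the field. *)
Lemma le_of_scaled_le (k : nat) (A C : R) : 0 <= C ->
  (forall th : R, 0 < th < 1 -> th ^+ k * A <= C) -> A <= C.
Proof.
move=> C0 H; rewrite leNgt; apply/negP => CA.
have A0 : 0 < A by apply: le_lt_trans CA.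
pose q := (C / A + 1) / 2; have CA1 : C / A < 1 by rewrite ltr_pdivrMr// mul1r.
have CA0 : 0 <= C / A by rewrite divr_ge0// ltW.
have q0 : 0 < q by rewrite /q; lra.
have q1 : q < 1 by rewrite /q; lra.
(* A root of order [k.+1] rather than [k] covers [k = 0]; it suffices because [q <= th ^+ k] and
   [C < q * A]. *)
pose th := expR (ln q / k.+1%:R).
have thk : th ^+ k.+1 = q.
  by rewrite -expRM_natl mulrC divfK ?pnatr_eq0// lnK.
have lq : ln q < 0 by rewrite ln_lt0// q0.
have th1 : th < 1 by rewrite -expR0 ltr_expR pmulr_llt0// invr_gt0 ltr0n.
have th0 : 0 < th by apply: expR_gt0.
have := H th; rewrite th0 th1 => /(_ isT); apply/negP; rewrite -ltNge.
apply: (@lt_le_trans _ _ (q * A)).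
  by rewrite -ltr_pdivrMr// /q; lra.
rewrite ler_pM2r// -thk exprS ler_piMl// ?exprn_ge0 ?ltW//.
Qed.

Lemma gauss_norm1 (T : finType) (b : T -> F) (e : T -> nat) (C : R) (t : T) :
    injective e -> 0 <= C ->
    (forall y, N y <= 1 -> N (\sum_t b t * y ^+ e t) <= C) ->
  N (b t) <= C.
Proof.
move=> einj C0 H; apply: (@le_of_scaled_le (e t)) => // th /andP[th0 th1].
(* [N y] is a root of [Q] exactly when two distinct monomials, one of them with nonzero coefficient,
   have equal absolute values at [y]. *)
pose Q : {poly R} := \prod_(x : T * T | (b x.1 != 0) && (x.1 != x.2))
  ((N (b x.1))%:P * 'X^(e x.1) - (N (b x.2))%:P * 'X^(e x.2)).
have Q0 : Q != 0.
  apply/prodf_neq0 => -[u w] /= /andP[bu uw].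
  apply/eqP => /(congr1 (fun p : {poly R} => p`_(e u))).
  rewrite coefB !coefCM !coefXn eqxx (inj_eq einj) (negbTE uw) mulr1 mulr0 subr0.
  by rewrite coef0 => /eqP; rewrite (absv_eq0 vV) (negbTE bu).
have [y /andP[thy y1] yQ] := dense_values_avoid (rootsR Q) (ltW th0) th1.
have {}yQ : Q.[N y] != 0.
  by apply: contra yQ => Qy; rewrite -roots_on_rootsR// in_itv.
apply: le_trans (H y (ltW y1)).
apply: (@le_trans _ _ (N (b t * y ^+ e t))).
  rewrite (absvM vV) (absvX vV) mulrC ler_wpM2l ?absv_ge0//.
  by apply: lerXn2r; rewrite ?nnegrE ?absv_ge0// ltW.
apply: (le_absv_sum_distinct vV (x := fun t => b t * y ^+ e t)) => u w bu uw.
apply: contra yQ => /eqP; rewrite !(absvM vV) !(absvX vV) => E.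
rewrite /Q horner_prod (bigD1 (u, w))/=; last first.
  by move: bu; rewrite mulf_eq0 negb_or => /andP[-> _].
by rewrite !(hornerE, hornerXn) E subrr mul0r.
Qed.

End GaussNorm.

Lemma base_expansion_inj n D (f g : 'I_n -> nat) :
    (forall i, (f i < D)%N) -> (forall i, (g i < D)%N) ->
    (\sum_i f i * D ^ i = \sum_i g i * D ^ i)%N ->
  f =1 g.
Proof.
elim: n f g => [|n IH] f g fD gD; first by move=> _ [].
have D0 : (0 < D)%N by apply: leq_ltn_trans (fD ord0).
have shift (h : 'I_n.+1 -> nat) : (\sum_i h i * D ^ i =
    (\sum_(i < n) h (lift ord0 i) * D ^ i) * D + h ord0)%N.
  rewrite big_ord_recl expn0 muln1 addnC big_distrl; congr (_ + _)%N.
  by apply: eq_bigr => i _; rewrite lift0 expnSr mulnA.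
rewrite !shift => E i.
have [->|] := eqVneq i ord0.
  have := congr1 (modn^~ D) E.
  by rewrite !modnMDl !modn_small.
rewrite eq_sym => /unlift_some[j -> _].
apply: (IH (f \o lift ord0) (g \o lift ord0)) => [k|k|] /=.
- exact: fD.
- exact: gD.
by have := congr1 (divn^~ D) E; rewrite !divnMDl// !divn_small// !addn0.
Qed.

(** Scaling the variables to the radii and substituting powers of one variable reduces this to
    [gauss_norm1]. *)
Lemma gauss_norm (R : realType) (F : fieldType) (v : F -> \bar R)
    (vV : is_valuation v)
    (dense_values : forall a b : R, 0 <= a -> a < b -> exists x, a < absv v x < b)
    n D (b : {ffun 'I_n -> 'I_D} -> F) (r : 'I_n -> R) (C : R)
    (t : {ffun 'I_n -> 'I_D}) :
    (forall i, 0 <= r i) -> 0 <= C ->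
    (forall x : 'I_n -> F, (forall i, absv v (x i) <= r i) ->
       absv v (\sum_f b f * \prod_i x i ^+ f i) <= C) ->
  absv v (b t) * \prod_i r i ^+ t i <= C.
Proof.
move=> r0 C0 H; apply: (@le_of_scaled_le _ (\sum_i t i)) => // th /andP[th0 th1].
(* A real radius need not be the absolute value of an element; density gives one up to the factor
   [th]. *)
have /choice[u ru] : forall i, exists u, th * r i <= absv v u <= r i.
  move=> i; have [ri|ri] := leP (r i) 0.
    exists 0; have -> : r i = 0 by apply/eqP; rewrite eq_le ri r0.
    by rewrite absv0// mulr0 lexx.
  have [||x /andP[x1 x2]] := dense_values (th * r i) (r i).
  - by rewrite mulr_ge0// ltW.
  - by rewrite gtr_pMl.
  - by exists x; rewrite !ltW.
pose b' (f : {ffun 'I_n -> 'I_D}) := b f * \prod_i u i ^+ f i.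
(* Kronecker substitution [x i = u i * y ^+ (D ^ i)]. *)
pose e (f : {ffun 'I_n -> 'I_D}) := (\sum_i f i * D ^ i)%N.
have einj : injective e.
  move=> f g /base_expansion_inj fg; apply/ffunP => i; apply: val_inj.
  by apply: fg => k; apply: ltn_ord.
have b't : absv v (b' t) <= C.
  apply: (@gauss_norm1 _ _ _ vV dense_values _ b' e C t einj C0) => y y1.
  have {}H := H (fun i => u i * y ^+ (D ^ i)).
  rewrite (eq_bigr (fun f => b f * \prod_i (u i * y ^+ (D ^ i)) ^+ f i)).
    apply: H => i; have /andP[_ ui] := ru i.
    rewrite (absvM vV) (absvX vV); apply: le_trans ui.
    by rewrite ler_piMr ?absv_ge0// exprn_ile1 ?absv_ge0.
  move=> f _; rewrite /b' /e -mulrA expr_sum -big_split/=; congr (_ * _).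
  by apply: eq_bigr => i _; rewrite exprMn -exprM mulnC.
apply: le_trans b't; rewrite /b' (absvM vV) (absv_prod vV) mulrCA.
rewrite ler_wpM2l ?absv_ge0// expr_sum -big_split/=.
apply: ler_prod => i _; have /andP[ur _] := ru i.
rewrite (absvX vV) -exprMn exprn_ge0 ?mulr_ge0 ?r0 ?(ltW th0)//=.
by apply: lerXn2r; rewrite ?nnegrE ?absv_ge0 ?mulr_ge0 ?r0 ?(ltW th0).
Qed.

Section Closure.
Variables (R : realType) (K Khat : fieldType).
Variables (v : K -> \bar R) (vhat : Khat -> \bar R).
Variable iota : {rmorphism K -> Khat}.
Hypothesis hv : nontrivial_valuation v.
Hypothesis hKhat : completed_algebraic_closure v vhat iota.

Lemma vhat_valuation : is_valuation vhat. Proof. by case: hKhat. Qed.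

Lemma absv_iota a : absv vhat (iota a) = absv v a.
Proof. by rewrite /absv; case: hKhat => _ ->. Qed.

(** Roots of an element of absolute value different from 1 have values arbitrarily close to 1, and
    the integer powers of such a root form a fine logarithmic mesh. *)
Lemma dense_absv (a b : R) : 0 <= a -> a < b -> exists x, a < absv vhat x < b.
Proof.
have vV := vhat_valuation; move=> a0 ab.
have [vval [x0 x00 vx0]] := hv.
pose w := ln (absv v x0).
have ax0 : 0 < absv v x0 by rewrite absv_gt0.
have w0 : w != 0.
  apply/eqP => w0; apply: vx0; by rewrite (val_fin vval)// -/w w0 oppr0.
(* Since [a] may be 0, it is first raised to a positive bound still below [b]. *)
pose A := ln (Num.max a (b / 2)); pose B := ln b.
have b0 : 0 < b by apply: le_lt_trans ab.
have mab : 0 < Num.max a (b / 2) by rewrite lt_max; apply/orP; right; lra.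
have AB : A < B.
  by rewrite ltr_ln ?posrE// gt_max ab; lra.
pose m := (Num.truncn (`|w| / (B - A))).+1.
have [eps [u [eps0 epsAB Nu]]] : exists (eps : R) (u : Khat),
    [/\ 0 < eps, eps < B - A & absv vhat u = expR eps].
  have [_ _ _ [Kbar [i [j [ij _ _]]]]] := hKhat.
  (* A root of X^m = x0. *)
  have [z zm] := @solve_monicpoly Kbar m
    (fun l => if l == 0%N then i x0 else 0) isT.
  rewrite big_ord_recl/= expr0 mulr1 big1 ?addr0 in zm; last first.
    by move=> l _; rewrite mul0r.
  have jz : absv vhat (j z) ^+ m = expR w.
    by rewrite -(absvX vV) -rmorphXn/= zm -ij absv_iota lnK.
  have z0 : 0 < absv vhat (j z).
    rewrite lt_neqAle absv_ge0 andbT eq_sym; apply/eqP => jz0.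
    by move: jz; rewrite jz0 expr0n/= => /esym/eqP; rewrite gt_eqF// expR_gt0.
  have lz : ln (absv vhat (j z)) = w / m%:R.
    have := congr1 (@ln R) jz; rewrite lnXn// expRK => <-.
    by rewrite -(mulr_natr (ln _) m) mulfK ?pnatr_eq0.
  have e0 : 0 < `|w| / m%:R by rewrite divr_gt0 ?normr_gt0.
  have eAB : `|w| / m%:R < B - A.
    rewrite ltr_pdivrMr// mulrC -ltr_pdivrMr ?subr_gt0//.
    exact: truncnS_gt.
  exists (`|w| / m%:R); have [wp|wn] := leP 0 w.
    by exists (j z); split=> //; rewrite ger0_norm// -lz lnK.
  exists (j z)^-1; split=> //.
  by rewrite (absvV vV) ltr0_norm// mulNr -lz expRN lnK.
have pw (l : int) : exists x, absv vhat x = expR (l%:~R * eps).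
  case: l => l.
    by exists (u ^+ l); rewrite (absvX vV) Nu expRM_natl.
  exists (u^-1 ^+ l.+1); rewrite (absvX vV) (absvV vV) Nu NegzE.
  by rewrite mulrNz mulNr expRN expRM_natl exprVn.
(* The first multiple of [eps] beyond [A]; as [eps < B - A], it is still below [B]. *)
have [x Nx] := pw (Num.floor (A / eps) + 1).
exists x; rewrite Nx.
have f1 : A < (Num.floor (A / eps) + 1)%:~R * eps.
  by rewrite -ltr_pdivrMr// floorD1_gt.
have f2 : (Num.floor (A / eps))%:~R * eps <= A.
  by rewrite -ler_pdivlMr// floor_le.
apply/andP; split.
  apply: (@le_lt_trans _ _ (Num.max a (b / 2))); first by rewrite le_max lexx.
  by rewrite -[X in X < _]lnK ?posrE// ltr_expR.
rewrite -[X in _ < X]lnK ?posrE// ltr_expR -/B.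
by move: f1 f2 epsAB; rewrite intrD mulrDl mul1r; lra.
Qed.

End Closure.

(** * The absolute polynomial on polydiscs *)

Section AbsolutePolynomial.
Variables (R : realType) (K Khat : fieldType).
Variables (v : K -> \bar R) (vhat : Khat -> \bar R).
Variable iota : {rmorphism K -> Khat}.
Hypothesis hv : nontrivial_valuation v.
Hypothesis hKhat : completed_algebraic_closure v vhat iota.
Let vV := vhat_valuation hKhat.
Local Notation N := (absv vhat).

Variables (n : nat) (f : {ffun 'I_n -> nat} -> set Khat).
Hypothesis hf : polynomial_over_B vhat iota f.

Lemma discB_center (a : K) (r : R) : 0 <= r -> discB vhat iota a r (iota a).
Proof. by move=> r0; rewrite /discB/= subrr absv0. Qed.

Lemma discB00 x : discB vhat iota 0 0 x <-> x = 0.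
Proof.
rewrite /discB/= rmorph0 sub0r absvN//; split=> [x0|->]; last by rewrite absv0.
by apply/eqP; rewrite -(absv_eq0 vV) eq_le x0 absv_ge0.
Qed.

(** A common bound on the exponents lets all sums run over a finite type. *)
Lemma support_bounded :
  exists D, forall alpha, f alpha <> discB vhat iota 0 0 ->
    forall i, (alpha i < D)%N.
Proof.
have /finite_seqP[s fs] := hf.2.
exists (\max_(alpha <- s) \max_i alpha i).+1 => alpha falpha i; rewrite ltnS.
have als : alpha \in s.
  by have : [set` s] alpha by rewrite -fs.
apply: leq_trans (leq_bigmax_seq _ als isT) => //.
exact: (leq_bigmax i).
Qed.

Variable D : nat.
Hypothesis supp : forall alpha, f alpha <> discB vhat iota 0 0 ->
    forall i, (alpha i < D)%N.

Definition exponents (be : {ffun 'I_n -> 'I_D}) : {ffun 'I_n -> nat} :=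
  [ffun i => be i : nat].

Lemma exponents_inj : injective exponents.
Proof.
move=> be ga /ffunP E; apply/ffunP => i; apply: val_inj.
by have := E i; rewrite !ffunE.
Qed.

Lemma exponents_surj alpha : f alpha <> discB vhat iota 0 0 ->
  exists be, alpha = exponents be.
Proof.
move=> /supp aD; exists [ffun i => Ordinal (aD i)].
by apply/ffunP => i; rewrite !ffunE.
Qed.

Definition coef_choice (c : {ffun 'I_n -> nat} -> Khat) :=
  forall alpha, f alpha (c alpha).

Lemma poly_sum_finite c (z : 'I_n -> Khat) : coef_choice c ->
  \sum_(alpha \in [set: {ffun 'I_n -> nat}]) c alpha * \prod_i z i ^+ alpha i =
  \sum_be c (exponents be) * \prod_i z i ^+ be i.
Proof.
move=> fc; rewrite -(@fsbig_widen _ _ _ _ (range exponents))//=; last first.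
  move=> alpha [_ nr] /=; have [fa|fa] := pselect (f alpha = discB vhat iota 0 0).
    have := fc alpha; rewrite fa => /discB00 ->; exact: mul0r.
  by case: nr; have [be ->] := exponents_surj fa; exists be.
rewrite (@fsbig_fwiden _ _ _ _ [seq exponents be | be <- enum {ffun 'I_n -> 'I_D}]).
- rewrite big_map big_enum/=; apply: eq_bigr => be _; congr (_ * _).
  by apply: eq_bigr => i _; rewrite ffunE.
- by move=> _ [be _ <-] /=; rewrite map_f// mem_enum.
- by rewrite map_inj_uniq ?enum_uniq//; apply: exponents_inj.
- by move=> _ [/= /mapP[be _ ->]] []; exists be.
Qed.

(** The Hasse derivative of order [be] at [a]. The truncated subtraction is harmless: the binomial
    coefficient vanishes when [al i < be i]. *)
Definition taylor_coef (a : 'I_n -> K) (c : {ffun 'I_n -> nat} -> Khat)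
    (be : {ffun 'I_n -> 'I_D}) : Khat :=
  \sum_al c (exponents al) *
    \prod_i (iota (a i) ^+ (al i - be i) *+ 'C(al i, be i)).

Lemma taylor_expansion a c (x : 'I_n -> Khat) :
  \sum_be c (exponents be) * \prod_i (iota (a i) + x i) ^+ be i =
  \sum_be taylor_coef a c be * \prod_i x i ^+ be i.
Proof.
under [RHS]eq_bigr do rewrite mulr_suml.
rewrite exchange_big; apply: eq_bigr => al _ /=.
under [RHS]eq_bigr do rewrite -mulrA.
rewrite -mulr_sumr; congr (_ * _).
under [RHS]eq_bigr do rewrite -big_split/=.
rewrite -(bigA_distr_bigA (fun i (k : 'I_D) =>
  (iota (a i) ^+ (al i - k) *+ 'C(al i, k)) * x i ^+ k)).
apply: eq_bigr => i _; rewrite exprDn.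
rewrite (big_ord_widen D (fun k : nat =>
  iota (a i) ^+ (al i - k) * x i ^+ k *+ 'C(al i, k)))//.
rewrite big_mkcond; apply: eq_bigr => k _ /=; rewrite mulrnAl; case: ltnP => //.
by move=> /bin_small ->; rewrite mulr0n.
Qed.

Lemma coef_bounded alpha : exists b, forall x, f alpha x -> N x <= b.
Proof.
have [a [r [r0 ->]]] := hf.1 alpha.
exists (Num.max (N (iota a)) r) => x /= xr.
rewrite -[x](subKr (iota a)); apply: absvB_le => //; rewrite le_max ?lexx//.
by rewrite xr orbT.
Qed.

Lemma coef_choice_ex : exists c, coef_choice c.
Proof.
have /choice[c fc] alpha : exists y, f alpha y; last by exists c.
have [a [r [r0 ->]]] := hf.1 alpha.
by exists (iota a); apply: discB_center.
Qed.

Definition taylor_sup a be : R :=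
  sup [set N (taylor_coef a c be) | c in coef_choice].

Lemma taylor_has_sup a be :
  has_sup [set N (taylor_coef a c be) | c in coef_choice].
Proof.
split; first by have [c fc] := coef_choice_ex; exists (N (taylor_coef a c be)), c.
have /choice[b fb] := coef_bounded.
pose p (al : {ffun 'I_n -> 'I_D}) := N (\prod_i (iota (a i) ^+ (al i - be i) *+ 'C(al i, be i))).
exists (\big[Num.max/0]_al (b (exponents al) * p al)) => _ [c fc <-].
apply: (absv_sum_le vV) => [|al _]; first exact: bigmax_ge_id.
rewrite (absvM vV); apply: le_trans (le_bigmax _ _ al).
by rewrite ler_wpM2r ?absv_ge0// fb.
Qed.

Lemma taylor_sup_ub a be c : coef_choice c -> N (taylor_coef a c be) <= taylor_sup a be.
Proof. by move=> fc; apply: ub_le_sup; [case: (taylor_has_sup a be)|exists c]. Qed.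

Lemma taylor_sup_ge0 a be : 0 <= taylor_sup a be.
Proof.
have [c fc] := coef_choice_ex; apply: le_trans (taylor_sup_ub a be fc).
exact: absv_ge0.
Qed.

(** The ultrametric inequality gives the upper bound. For the lower one [gauss_norm] bounds each
    monomial for each fixed choice of coefficients, and the supremum over choices is taken
    afterwards. *)
Lemma abs_polyE a r : (forall i, 0 <= r i) ->
  abs_poly vhat f (polydiscB vhat iota a r) =
  (\big[Num.max/0]_be (taylor_sup a be * \prod_i r i ^+ be i))%:E.
Proof.
move=> r0; apply/eqP; rewrite eq_le; apply/andP; split.
  apply: ge_ereal_sup => _ [_ [c [z [fc Bz ->]]] <-]; rewrite lee_fin.
  rewrite poly_sum_finite//.
  have -> : z = (fun i => iota (a i) + (z i - iota (a i))).
    by apply/funext => i; rewrite subrKC.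
  rewrite taylor_expansion.
  apply: (absv_sum_le vV) => [|be _]; first exact: bigmax_ge_id.
  rewrite (absvM vV); apply: le_trans (le_bigmax _ _ be).
  apply: ler_pM; rewrite ?absv_ge0 ?taylor_sup_ub//.
  rewrite (absv_prod vV); apply: ler_prod => i _; rewrite absv_ge0/= (absvX vV).
  by apply: lerXn2r; rewrite ?nnegrE ?absv_ge0// (absv_distC vV); apply: Bz.
set S := abs_poly _ _ _.
have valS c x : coef_choice c -> (forall i, N (x i) <= r i) ->
    ((N (\sum_be taylor_coef a c be * \prod_i x i ^+ be i))%:E <= S)%E.
  move=> fc xr; apply: ereal_sup_ubound.
  exists (\sum_be taylor_coef a c be * \prod_i x i ^+ be i) => //.
  exists c, (fun i => iota (a i) + x i); split=> //.
    by move=> i; rewrite opprD addNKr absvN.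
  by rewrite poly_sum_finite// taylor_expansion.
have [c0 fc0] := coef_choice_ex.
have S0 : (0 <= S)%E.
  apply: le_trans (valS c0 (fun=> 0) fc0 _) => [|i]; last by rewrite absv0.
  by rewrite lee_fin absv_ge0.
case: S S0 valS => [C||//]; last by move=> *; rewrite leey.
rewrite !lee_fin => C0 valS; apply: bigmax_le => // be _.
have leC c : coef_choice c -> N (taylor_coef a c be) * \prod_i r i ^+ be i <= C.
  move=> fc; apply: (gauss_norm vV (dense_absv hv hKhat)) => // x xr.
  by have := valS c x fc xr; rewrite lee_fin.
have pr0 : 0 <= \prod_i r i ^+ be i by apply: prodr_ge0 => i _; rewrite exprn_ge0.
have [->|p0] := eqVneq (\prod_i r i ^+ be i) 0; first by rewrite mulr0.
have {p0}pr0 : 0 < \prod_i r i ^+ be i by rewrite lt_neqAle eq_sym p0.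
rewrite -ler_pdivlMr//; apply: ge_sup; first by case: (taylor_has_sup a be).
by move=> _ [c fc <-]; rewrite ler_pdivlMr//; apply: leC.
Qed.

(** Otherwise |f| vanishes on a polydisc around [a] that also contains the one of the same radius
    around 0, and the Gauss norm at 0 makes every coefficient vanish. *)
Lemma taylor_sup_gt0 a : nonzero_polynomial vhat iota f ->
  exists be, 0 < taylor_sup a be.
Proof.
move=> [alpha falpha]; have [al Eal] := exponents_surj falpha.
apply: contrapT => H.
have M0 be : taylor_sup a be = 0.
  apply/eqP; rewrite eq_le taylor_sup_ge0 andbT leNgt; apply/negP => M0.
  by apply: H; exists be.
pose r := 1 + \big[Num.max/0]_i N (iota (a i)).
have r0 : 0 < r by rewrite /r ltr_pwDl// bigmax_ge_id.
have ar i : N (iota (a i)) <= r.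
  by apply: le_trans (le_bigmax 0 (fun i => N (iota (a i))) i) _; rewrite lerDr.
(* A nonempty coefficient disc other than {0} has a nonzero element. *)
have [x fx x0] : exists2 x, f alpha x & x != 0.
  apply: contrapT => K0; apply: falpha; apply/seteqP; split=> x.
    move=> fx; apply/discB00; apply/eqP/negP => /negP x0; apply: K0.
    by exists x.
  move/discB00 => ->; have [c fc] := coef_choice_ex.
  have [c0|cn0] := eqVneq (c alpha) 0; last by case: K0; exists (c alpha).
  by rewrite -c0; apply: fc.
have [c0 fc0] := coef_choice_ex.
pose c ga := if ga == alpha then x else c0 ga.
have fc : coef_choice c by move=> ga; rewrite /c; case: eqP => [->|_].
have := @abs_polyE a (fun=> r) (fun=> ltW r0).
rewrite bigmax_eq_id => [S0|be _]; last by rewrite M0 mul0r.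
have : N (c (exponents al)) * \prod_(i < n) r ^+ al i <= 0.
  apply: (gauss_norm vV (dense_absv hv hKhat) (b := c \o exponents)
    (r := fun=> r)) => [i||z zr //=].
  - exact: ltW.
  - exact: lexx.
  rewrite -lee_fin -S0; apply: ereal_sup_ubound.
  exists (\sum_be c (exponents be) * \prod_i z i ^+ be i) => //.
  exists c, z; split=> //; last by rewrite poly_sum_finite.
  by move=> i; apply: absvB_le.
rewrite -Eal /c eqxx pmulr_lle0; last first.
  by apply: prodr_gt0 => i _; rewrite exprn_gt0.
by rewrite leNgt absv_gt0// x0.
Qed.

End AbsolutePolynomial.

(** * Discs and their geodesics *)

Section DiscGeometry.
Variables (R : realType) (K Khat : fieldType).
Variables (v : K -> \bar R) (vhat : Khat -> \bar R).
Variable iota : {rmorphism K -> Khat}.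
Hypothesis hv : nontrivial_valuation v.
Hypothesis hK : valuation_complete v.
Hypothesis hKhat : completed_algebraic_closure v vhat iota.
Let vV := hv.1.
Let vhatV := vhat_valuation hKhat.
Local Notation N := (absv v).
Local Notation disc := (discB vhat iota).

Lemma le_val_absv w x : (w%:E <= vhat x)%E = (absv vhat x <= expR (- w)).
Proof.
have [->|x0] := eqVneq x 0.
  by rewrite absv0// expR_ge0 (val_eqy vhatV 0).2// leey.
rewrite (val_fin vhatV)// lee_fin lerNr.
by rewrite -[RHS]ler_ln ?posrE ?expR_gt0 ?absv_gt0// expRK.
Qed.

Lemma discHE a w : discH vhat iota a w = disc a (expR (- w)).
Proof. by apply/funext => z; rewrite /discH /discB/= le_val_absv. Qed.

Lemma polydiscHE n (a : 'I_n -> K) w :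
  polydiscH vhat iota a w = polydiscB vhat iota a (fun i => expR (- w i)).
Proof.
by apply/seteqP; split=> z H i; have := H i; rewrite le_val_absv.
Qed.

Lemma val_polyE n (f : {ffun 'I_n -> nat} -> set Khat) B A :
  abs_poly vhat f B = A%:E -> 0 < A -> val_poly vhat f B = (- ln A)%:E.
Proof.
move=> BA A0; apply/eqP; rewrite eq_le; apply/andP; split; last first.
  apply: le_ereal_inf_tmp => _ [y By <-]; rewrite le_val_absv opprK lnK//.
  by rewrite -lee_fin -BA; apply: ereal_sup_ubound; exists y.
set L := val_poly _ _ _.
have AL w : (w%:E <= L)%E -> A <= expR (- w).
  move=> wL; rewrite -lee_fin -BA; apply: ge_ereal_sup => _ [y By <-].
  rewrite lee_fin -le_val_absv; apply: le_trans wL _.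
  by apply: ereal_inf_lbound; exists y.
case: L AL => [l||] AL; last by rewrite leNye.
  have := AL l (lexx _); rewrite -ler_ln ?posrE ?expR_gt0// expRK lee_fin; lra.
(* An infinite valuation would bound [A] by A / e, with e the base of the exponential. *)
exfalso; have := AL (1 - ln A) (leey _); rewrite -ler_ln ?posrE ?expR_gt0// expRK; lra.
Qed.

Lemma disc_mem a a' r : disc a r (iota a') <-> N (a - a') <= r.
Proof. by rewrite /discB/= -rmorphB (absv_iota hKhat). Qed.

Lemma sub_disc a a' r r' : N (a - a') <= r' -> r <= r' -> disc a r `<=` disc a' r'.
Proof.
move=> aa' rr' z; rewrite /discB/= => az.
have -> : iota a' - z = (iota a - z) - iota (a - a') by rewrite rmorphB; ring.
by apply: (absvB_le vhatV); rewrite ?(absv_iota hKhat)// (le_trans az).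
Qed.

Lemma eq_disc a a' r : N (a - a') <= r -> disc a r = disc a' r.
Proof.
by move=> aa'; apply/seteqP; split; apply: sub_disc; rewrite // (absv_distC vV).
Qed.

(** Density of values supplies a point of [Khat] whose distance to the centre lies strictly between
    two different radii. *)
Lemma disc_radius_inj a a' r r' : 0 <= r -> 0 <= r' ->
  disc a r = disc a' r' -> r = r'.
Proof.
suff W b b' s s' : 0 <= s -> 0 <= s' -> disc b s = disc b' s' -> s' <= s.
  by move=> r0 r'0 E; apply/eqP; rewrite eq_le !(W _ _ _ _ _ _ E, W _ _ _ _ _ _ (esym E)).
move=> s0 s'0 E; rewrite leNgt; apply/negP => ss'.
have [x /andP[sx xs']] := dense_absv hv hKhat s0 ss'.
have bb' : N (b' - b) <= s'.
  by apply/disc_mem; rewrite -E; apply/disc_mem; rewrite subrr absv0.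
have : disc b s (iota b - x).
  by rewrite E (eq_disc bb') /discB/= subKr ltW.
by rewrite /discB/= subKr leNgt sx.
Qed.

Lemma nested_discE a a' r r' : 0 <= r -> 0 <= r' ->
  nested (disc a r) (disc a' r') <-> N (a - a') <= Num.max r r'.
Proof.
move=> r0 r'0; rewrite le_max; split.
  move=> [] H; apply/orP; [right|left].
    rewrite (absv_distC vV); apply/disc_mem/H; apply/disc_mem.
    by rewrite subrr absv0.
  by apply/disc_mem/H; apply/disc_mem; rewrite subrr absv0.
have [rr'|/ltW r'r] := leP r r'.
  move=> H; left; apply: sub_disc => //.
  by case/orP: H => // /le_trans; apply.
move=> H; right; apply: sub_disc => //; rewrite (absv_distC vV).
by case/orP: H => // /le_trans; apply.
Qed.

Lemma radiusB_disc a r : 0 <= r -> radiusB vhat iota (disc a r) = r.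
Proof.
move=> r0; apply: xget_unique; first by split=> //; exists a.
by move=> s [s0 [b]] /esym; apply: disc_radius_inj.
Qed.

Lemma radiusH_disc a r : 0 < r -> radiusH vhat iota (disc a r) = - ln r.
Proof.
move=> r0; apply: xget_unique.
  by exists a; rewrite discHE opprK lnK.
move=> w [b]; rewrite discHE => /disc_radius_inj ->; rewrite ?expR_ge0 ?ltW//.
by rewrite expRK opprK.
Qed.

Lemma center_near a r : 0 <= r -> N (a - Defs.center vhat iota (disc a r)) <= r.
Proof.
move=> r0; have [s s0 E] : exists2 s, 0 <= s &
    disc a r = disc (Defs.center vhat iota (disc a r)) s.
  apply: (@xgetPex _ 0 [set b | exists2 s, 0 <= s & disc a r = disc b s]).
  by exists a, r.
by apply/disc_mem; rewrite {1}E; apply/disc_mem; rewrite subrr absv0.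
Qed.

(** The chosen centres move the difference of centres by less than its absolute value, hence do not
    change that value. *)
Lemma join_not_nested a a' r r' : 0 <= r -> 0 <= r' ->
    ~ nested (disc a r) (disc a' r') ->
  join vhat iota (disc a r) (disc a' r') = disc a (N (a - a')).
Proof.
move=> r0 r'0 nn; rewrite /join asboolF//.
move: nn; rewrite nested_discE// => /negP; rewrite -ltNge gt_max => /andP[ra ra'].
set b := Defs.center _ _ (disc a r); set b' := Defs.center _ _ (disc a' r').
have ab : N (a - b) <= r by apply: center_near.
have ab' : N (a' - b') <= r' by apply: center_near.
have bb' : N (b - b') = N (a - a').
  have -> : b - b' = (a - a') + ((a' - b') - (a - b)) by ring.
  apply: (absvD_dominant vV); apply: (absvD_lt vV); first exact: le_lt_trans ab' _.
  by rewrite (absvN vV); apply: le_lt_trans ra.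
rewrite -rmorphB (absv_iota hKhat) bb'; apply/esym/eq_disc.
by apply: le_trans ab (ltW ra).
Qed.

Lemma factor_polydisc n (a : 'I_n -> K) (r : 'I_n -> R) i :
  (forall i, 0 <= r i) -> Defs.factor i (polydiscB vhat iota a r) = disc (a i) (r i).
Proof.
move=> r0; apply/seteqP; split=> [_ [z Bz <-]|y ydisc]; first exact: Bz.
exists (fun k => if k == i then y else iota (a k)); last by rewrite eqxx.
by move=> k /=; case: eqP => [->//|_]; rewrite subrr absv0.
Qed.

Lemma eq_polydisc n (a a' : 'I_n -> K) (r : 'I_n -> R) :
  (forall i, N (a i - a' i) <= r i) ->
  polydiscB vhat iota a r = polydiscB vhat iota a' r.
Proof.
move=> aa'; apply/seteqP; split=> z H i.
  have : disc (a i) (r i) (z i) by exact: H.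
  by rewrite (eq_disc (aa' i)).
have : disc (a' i) (r i) (z i) by exact: H.
by rewrite -(eq_disc (aa' i)).
Qed.

(* Completeness of [K] is needed because a geodesic for [dH] on an unbounded
   interval may run towards a point, a disc of radius 0 outside [H^n]. *)
Lemma common_center (T : Type) (L : set T) (a : T -> K) (r : T -> R) :
    (forall s t, L s -> L t -> N (a s - a t) <= Num.max (r s) (r t)) ->
    (exists2 t0, L t0 & forall t, L t -> r t0 <= r t) \/
    (forall t, L t -> 0 < r t) /\ (forall e, 0 < e -> exists2 t, L t & r t < e) ->
  exists b, forall t, L t -> N (b - a t) <= r t.
Proof.
move=> chain [[t0 Lt0 t0min]|[rpos rsmall]].
  by exists (a t0) => t Lt; rewrite -(max_idPr (t0min t Lt)) chain.
(* Along radii tending to 0 the centres form a Cauchy sequence by [chain]; its limit is the common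
   centre. *)
have /choice[u uP] (k : nat) : exists t, L t /\ r t < k.+1%:R^-1.
  by have [|t Lt rt] := rsmall k.+1%:R^-1; [rewrite invr_gt0|exists t].
have small (e : R) : 0 < e -> exists M : nat, forall k, (M <= k)%N -> r (u k) < e.
  move=> e0; exists (Num.truncn e^-1) => k Mk; have [_ /lt_trans] := uP k; apply.
  rewrite invf_plt ?posrE//; apply: lt_le_trans (truncnS_gt _) _.
  by rewrite ler_nat ltnS.
have [l lP] : exists l : K, forall e : R, 0 < e -> exists M : nat, forall k : nat,
    (M <= k)%N -> N (a (u k) - l) < e.
  apply: hK => e /small[M HM]; exists M => m k Mm Mk.
  have [Lm _] := uP m; have [Lk _] := uP k.
  by apply: le_lt_trans (chain _ _ Lm Lk) _; rewrite gt_max !HM.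
exists l => t Lt; have rt := rpos t Lt.
have [M1 H1] := lP _ rt; have [M2 H2] := small _ rt.
set k := maxn M1 M2.
have -> : l - a t = (a (u k) - a t) - (a (u k) - l) by ring.
apply: (absvB_le vV); last by apply/ltW/H1; rewrite leq_maxl.
have [Lk _] := uP k; apply: le_trans (chain _ _ Lk Lt) _.
by rewrite ge_max lexx andbT; apply/ltW/H2; rewrite leq_maxr.
Qed.

Section Geodesics.
(* [phi] is the height of a disc as a function of its radius: the identity on
   [r >= 0] for [dB] and [ln] on [r > 0] for [dH]. *)
Variables (rad : set Khat -> R) (phi : R -> R) (Q : R -> Prop).
Hypothesis Q_ge0 : forall r, Q r -> 0 <= r.
Hypothesis Q_up : forall r r', Q r -> r <= r' -> Q r'.
Hypothesis phi_mono : forall r r', Q r -> Q r' -> (phi r <= phi r') = (r <= r').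
Hypothesis phi_small : forall e : R, 0 < e ->
  exists x, forall r, Q r -> phi r < x -> r < e.
Hypothesis rad_phi : forall a a' r r', Q r -> Q r' ->
  `|rad (disc a r) - rad (disc a' r')| = `|phi r - phi r'|.

Lemma phi_le_max x y z : Q x -> Q y -> Q z ->
  (phi x <= Num.max (phi y) (phi z)) = (x <= Num.max y z).
Proof. by move=> Qx Qy Qz; rewrite !le_max !phi_mono. Qed.

(** The radius of the smallest disc containing both, nested or not; it removes the case distinction
    from the distance. *)
Definition join_radius (a a' : K) (r r' : R) := Num.max (Num.max r r') (N (a - a')).

Lemma join_radius_Q a a' r r' : Q r -> Q (join_radius a a' r r').
Proof. by move=> Qr; apply: (Q_up Qr); rewrite !le_max lexx. Qed.

Lemma disc_distE a a' r r' : Q r -> Q r' ->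
  disc_dist vhat iota rad (disc a r) (disc a' r') =
  2 * phi (join_radius a a' r r') - phi r - phi r'.
Proof.
move=> Qr Qr'; have r0 := Q_ge0 Qr; have r'0 := Q_ge0 Qr'.
rewrite /disc_dist; case: asboolP => [|nn].
  rewrite nested_discE// => aa'; rewrite rad_phi// /join_radius (max_idPl aa').
  have [rr'|/ltW rr'] := leP r r'.
    by have := rr'; rewrite -phi_mono// => le; rewrite distrC ger0_norm ?subr_ge0//; lra.
  by have := rr'; rewrite -phi_mono// => le; rewrite ger0_norm ?subr_ge0//; lra.
rewrite join_not_nested//.
move: nn; rewrite nested_discE// => /negP; rewrite -ltNge => lt.
have := lt; rewrite gt_max => /andP[/ltW le1 /ltW le2].
have Qa := Q_up Qr le1.
rewrite !rad_phi// /join_radius (max_idPr (ltW lt)).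
rewrite distrC ger0_norm ?subr_ge0 ?phi_mono//.
by rewrite ger0_norm ?subr_ge0 ?phi_mono//; lra.
Qed.

Lemma geodesic_pieces n p (I : set R) (gamma : R -> set ('I_n -> Khat)) :
    1 < p ->
    geodesic [set B | exists a r, (forall i, Q (r i)) /\ B = polydiscB vhat iota a r]
      (lp_dist (disc_dist vhat iota rad) p) I gamma ->
  exists (A : finType) (J : A -> set R) (b : A -> 'I_n -> K) (c d : A -> 'I_n -> R),
    [/\ forall k, closed_interval (J k), I = \bigcup_k J k &
        forall k t, J k t -> exists r, [/\ forall i, Q (r i),
          forall i, phi (r i) = c k i + d k i * t &
          gamma t = polydiscB vhat iota (b k) r]].
Proof.
move=> p1 [cI gI [lambda l0 gd]].
have /choice[a /choice[r arP]] : forall t, exists a r, I t ->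
    (forall i, Q (r i)) /\ gamma t = polydiscB vhat iota a r.
  move=> t; have [It|nIt] := pselect (I t); last by exists (fun=> 0), (fun=> 0).
  by have [a [r ar]] := gI t It; exists a, r.
have Qr t i : I t -> Q (r t i) by case/arP.
pose jr i s t := join_radius (a s i) (a t i) (r s i) (r t i).
pose h i t := phi (r t i); pose j i s t := phi (jr i s t).
have jQ i s t : I s -> Q (jr i s t) by move=> Is; apply: join_radius_Q; apply: Qr.
have jC i s t : j i s t = j i t s.
  by rewrite /j /jr /join_radius (absv_distC vV) (maxC (r s i)).
have hj i s t : I s -> I t -> h i s <= j i s t.
  move=> Is It; rewrite /h /j phi_mono; [|exact: Qr|exact: jQ].
  by rewrite /jr /join_radius !le_max lexx.
have jU i s t u : I s -> I t -> I u -> j i s u <= Num.max (j i s t) (j i t u).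
  move=> Is It Iu; suff : jr i s u <= Num.max (jr i s t) (jr i t u).
    by rewrite -phi_le_max//; apply: jQ.
  rewrite {1}/jr {1}/join_radius !ge_max; apply/andP; split.
    by rewrite /jr /join_radius !le_max !lexx !orbT.
  have -> : a s i - a u i = (a s i - a t i) + (a t i - a u i) by ring.
  by apply: (absvD_le vV); rewrite /jr /join_radius !le_max !lexx ?orbT.
pose e i s t := 2 * j i s t - h i s - h i t.
have jss i s : I s -> j i s s = h i s.
  move=> Is; rewrite /j /jr /join_radius maxxx subrr absv0//.
  by rewrite (max_idPl (Q_ge0 (Qr s i Is))).
have eE i : exists l, forall s t, I s -> I t -> e i s t = l * `|s - t|.
  apply: (lp_geodesic_components p1 (ltW l0) (e := e)).
  - move=> k s t Is It; have := hj k s t Is It; have := hj k t s It Is.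
    by rewrite /e (jC k t s); lra.
  - by move=> k s t Is It; rewrite /e jC; ring.
  - by move=> k s Is; rewrite /e jss//; ring.
  - move=> k s t u Is It Iu; have := jU k s t u Is It Iu.
    have := hj k t u It Iu; have := hj k t s It Is; rewrite (jC k t s) /e.
    by rewrite le_max => ? ? /orP[]; lra.
  - move=> s t Is It; rewrite -(gd s t Is It) /lp_dist; congr (_ `^ _).
    apply: eq_bigr => i0 _; congr (_ `^ _).
    have [Qs ->] := arP s Is; have [Qt ->] := arP t It.
    rewrite !factor_polydisc => [|k|k]; [|exact: Q_ge0|exact: Q_ge0].
    by rewrite disc_distE.
have tree i : exists (L : bool -> set R) (cd : bool -> K * R * R),
    [/\ forall k, closed_interval (L k), I = \bigcup_k L k,
        forall k t, L k t -> phi (r t i) = (cd k).1.2 + (cd k).2 * t &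
        forall k t, L k t -> N ((cd k).1.1 - a t i) <= r t i].
  have [l el] := eE i.
  have [L [c [d [cL IL hL jL]]]] : exists (L : bool -> set R) (c d : bool -> R),
    [/\ forall k, closed_interval (L k), I = \bigcup_k L k,
        forall k t, L k t -> h i t = c k + d k * t &
        forall k s t, L k s -> L k t -> j i s t <= Num.max (h i s) (h i t)].
    by apply: (tree_geodesic_pieces cI _ _ _ el) => *; [exact: jC|exact: hj|exact: jU].
  have LI k t : L k t -> I t by move=> Lt; rewrite IL; exists k.
  have /choice[b bP] k : exists b, forall t, L k t -> N (b - a t i) <= r t i.
    have [[t0 Lt0]|L0] := pselect (exists t, L k t); last first.
      by exists 0 => t Lt; case: L0; exists t.
    have QL t : L k t -> Q (r t i) by move=> /LI/Qr.
    apply: common_center.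
      move=> s t Ls Lt; have Is := LI k s Ls; have It := LI k t Lt.
      apply: (@le_trans _ _ (jr i s t)); first by rewrite /jr /join_radius !le_max lexx orbT.
      have := jL k s t Ls Lt; rewrite phi_le_max//; [exact: jQ|exact: Qr|exact: Qr].
    (* These are the two situations of [common_center]; [phi_small] turns heights unbounded below
       into radii tending to 0. *)
    have [[t1 Lt1 t1min]|unb] := affine_min_or_unbounded (cL k) (ex_intro _ t0 Lt0) (hL k).
      left; exists t1 => // t Lt.
      have := t1min t Lt; rewrite /h phi_mono//; exact: QL.
    right; split=> [t Lt|eps eps0].
      have [s Ls] := unb (h i t).
      rewrite ltNge phi_mono -?ltNge; [|exact: QL|exact: QL].
      by apply: le_lt_trans; apply: Q_ge0; apply: QL.
    have [x xP] := phi_small eps0; have [s Ls hs] := unb x.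
    by exists s => //; apply: xP => //; apply: QL.
  by exists L, (fun k => (b k, c k, d k)).
have {tree}[L /choice[cd cdP]] := choice tree.
(* One piece for each choice of a rising or falling branch in every factor. For [n = 0] the
   intersection over [i] is the whole line, hence the explicit [I]. *)
exists {ffun 'I_n -> bool}, (fun s : {ffun 'I_n -> bool} => I `&` \bigcap_i L i (s i)).
exists (fun s : {ffun 'I_n -> bool} => fun i => (cd i (s i)).1.1).
exists (fun s : {ffun 'I_n -> bool} => fun i => (cd i (s i)).1.2).
exists (fun s : {ffun 'I_n -> bool} => fun i => (cd i (s i)).2); split.
- move=> s; apply: closed_intervalI => //; apply: closed_interval_bigcap => i.
  by have [] := cdP i.
- apply/seteqP; split=> [t It|t [s _ []]//].
  have /choice[s sP] i : exists k, L i k t.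
    by have [_ E _ _] := cdP i; move: It; rewrite E => -[k _ Lkt]; exists k.
  by exists (finfun s) => //; split=> // i _; rewrite ffunE.
move=> s t [It Lt]; exists (r t); have [Qt ->] := arP t It.
split=> // [i|]; first by have [_ _ + _] := cdP i; apply; apply: Lt.
apply/esym/eq_polydisc => i; have [_ _ _] := cdP i; apply; exact: Lt.
Qed.

End Geodesics.
End DiscGeometry.

(** * Polynomials along geodesics *)

Lemma bigmax_attained (R : realDomainType) (T : finType) (F : T -> R) :
  \big[Num.max/0]_t F t = 0 \/ exists t, \big[Num.max/0]_t F t = F t.
Proof.
apply: (big_ind (fun x => x = 0 \/ exists t, x = F t)); first by left.
  by move=> x y Px Py; rewrite /Num.max; case: ifP.
by move=> t _; right; exists t.
Qed.

Section PiecewisePolynomials.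
Variables (R : realType) (K Khat : fieldType).
Variables (v : K -> \bar R) (vhat : Khat -> \bar R).
Variable iota : {rmorphism K -> Khat}.
Hypothesis hv : nontrivial_valuation v.
Hypothesis hK : valuation_complete v.
Hypothesis hKhat : completed_algebraic_closure v vhat iota.
Variables (n : nat) (p : R) (f : {ffun 'I_n -> nat} -> set Khat).
Hypothesis p1 : 1 < p.
Hypothesis hf : polynomial_over_B vhat iota f.
Local Notation taylor D := (@taylor_sup R K Khat vhat iota n f D).

(** Finiteness makes the passage through [fine] lossless. *)
Lemma abs_poly_fin_ge0 B : Bn vhat iota B ->
  abs_poly vhat f B \is a fin_num /\ (0 <= abs_poly vhat f B)%E.
Proof.
move=> [a [r [r0 ->]]]; have [D supp] := support_bounded hf.
by rewrite (abs_polyE hv hKhat hf supp)//; split=> //; rewrite lee_fin bigmax_ge_id.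
Qed.

Lemma abs_poly_geodesic I (gamma : R -> set ('I_n -> Khat)) :
    geodesic (@Bn R K Khat vhat iota n) (dBp vhat iota p) I gamma ->
  finite_piecewise_polynomial I (fun t => fine (abs_poly vhat f (gamma t))).
Proof.
move=> geo; have [D supp] := support_bounded hf.
have [|||||A [J [b [c [d [cJ IJ JP]]]]]] := geodesic_pieces hv hK hKhat
    (rad := radiusB vhat iota) (phi := id) (Q := fun r => 0 <= r) _ _ _ _ _ p1 geo.
- by [].
- by move=> r r' /le_trans; apply.
- by [].
- by move=> e _; exists e.
- by move=> a a' r r' r0 r'0; rewrite !(radiusB_disc hv hKhat).
apply: (finite_piecewise_bigcup IJ) => k.
pose q (be : {ffun 'I_n -> 'I_D}) : {poly R} := (taylor D (b k) be)%:P *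
  \prod_i ((c k i)%:P + (d k i)%:P * 'X) ^+ be i.
(* The zero polynomial stands for the initial value 0 of the maximum. *)
apply: (finite_piecewise_max
  (qs := 0 :: [seq q be | be <- enum {ffun 'I_n -> 'I_D}])) => //.
move=> t Jt; have [r [r0 rE ->]] := JP k t Jt.
rewrite (abs_polyE hv hKhat hf supp)//=.
have qE be : taylor D (b k) be * \prod_i r i ^+ be i = (q be).[t].
  rewrite /q hornerM hornerC horner_prod; congr (_ * _).
  by apply: eq_bigr => i _; rewrite horner_exp !hornerE rE.
under eq_bigr do rewrite qE.
split=> [|q']; rewrite ?inE.
  have [->|[be ->]] := bigmax_attained (fun be => (q be).[t]).
    by exists 0; rewrite ?mem_head// horner0.
  by exists (q be) => //; rewrite in_cons map_f ?orbT// mem_enum.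
move=> /orP[/eqP->|/mapP[be _ ->]]; first by rewrite horner0 bigmax_ge_id.
exact: (le_bigmax 0 (fun be => (q be).[t])).
Qed.

Section NonZero.
Hypothesis f0 : nonzero_polynomial vhat iota f.

(** Positivity is what allows the logarithm to be taken; for the zero polynomial the valuation would
    be infinite. *)
Lemma abs_poly_gt0 D (supp : forall alpha, f alpha <> discB vhat iota 0 0 ->
    forall i, (alpha i < D)%N) (a : 'I_n -> K) (r : 'I_n -> R) :
    (forall i, 0 < r i) ->
  0 < \big[Num.max/0]_be (taylor D a be * \prod_i r i ^+ be i).
Proof.
move=> r0; have [be Mbe] := taylor_sup_gt0 hv hKhat hf supp a f0.
apply: lt_le_trans (le_bigmax 0 _ be); rewrite mulr_gt0//.
by apply: prodr_gt0 => i _; rewrite exprn_gt0.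
Qed.

Lemma val_poly_disc D (supp : forall alpha, f alpha <> discB vhat iota 0 0 ->
    forall i, (alpha i < D)%N) (a : 'I_n -> K) (r : 'I_n -> R) :
    (forall i, 0 < r i) ->
  val_poly vhat f (polydiscB vhat iota a r) =
  (- ln (\big[Num.max/0]_be (taylor D a be * \prod_i r i ^+ be i)))%:E.
Proof.
move=> r0; apply: (val_polyE hKhat); last exact: abs_poly_gt0.
by apply: (abs_polyE hv hKhat hf supp) => i; apply: ltW.
Qed.

Lemma val_poly_fin B : Hn vhat iota B -> val_poly vhat f B \is a fin_num.
Proof.
move=> [a [w ->]]; have [D supp] := support_bounded hf.
by rewrite (polydiscHE hKhat) (val_poly_disc supp)// => i; apply: expR_gt0.
Qed.

(** The logarithms of the radii are affine in [t], so the logarithm of each monomial is affine and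
    the valuation is a minimum of affine functions. *)
Lemma val_poly_geodesic I (gamma : R -> set ('I_n -> Khat)) :
    geodesic (@Hn R K Khat vhat iota n) (dHp vhat iota p) I gamma ->
  finite_piecewise_linear I (fun t => fine (val_poly vhat f (gamma t))).
Proof.
move=> [cI Hgamma geo]; have [D supp] := support_bounded hf.
have [||||||A [J [b [c [d [cJ IJ JP]]]]]] := geodesic_pieces hv hK hKhat
    (rad := radiusH vhat iota) (phi := @ln R) (Q := fun r => 0 < r) _ _ _ _ _ p1
    (And3 cI _ geo).
- by move=> r /ltW.
- by move=> r r' /lt_le_trans; apply.
- by move=> r r' r0 r'0; rewrite ler_ln.
- move=> e e0; exists (ln e) => r r0; by rewrite ltr_ln.
- move=> a a' r r' r0 r'0; rewrite !(radiusH_disc hv hKhat)//.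
  by rewrite -opprD normrN.
- move=> t /Hgamma[a [w ->]]; exists a, (fun i => expR (- w i)).
  by rewrite (polydiscHE hKhat); split=> // i; apply: expR_gt0.
apply: (finite_piecewise_bigcup IJ) => k.
pose M be := taylor D (b k) be.
pose q (be : {ffun 'I_n -> 'I_D}) : {poly R} :=
  (\sum_i d k i *+ be i) *: 'X + (ln (M be) + \sum_i c k i *+ be i)%:P.
apply: finite_piecewiseN; first by move=> x; rewrite size_polyN.
(* Only positive coefficients are kept: [ln 0] is a default value, and a vanishing monomial never
   attains the positive maximum. *)
apply: (finite_piecewise_max
  (qs := [seq q be | be <- enum {ffun 'I_n -> 'I_D} & 0 < M be])) => //.
  move=> _ /mapP[be _ ->]; rewrite (leq_trans (size_polyD _ _))// geq_max.
  by rewrite (leq_trans (size_scale_leq _ _)) ?size_polyX// size_polyC; case: eqP.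
move=> t Jt; have [r [r0 rE ->]] := JP k t Jt.
rewrite (val_poly_disc supp)//= opprK.
have prod0 (be : {ffun 'I_n -> 'I_D}) : 0 < \prod_i r i ^+ be i.
  by apply: prodr_gt0 => i _; rewrite exprn_gt0.
have qE be : 0 < M be -> ln (M be * \prod_i r i ^+ be i) = (q be).[t].
  move=> M0; rewrite lnM ?posrE// /q !hornerE/= -addrA [RHS]addrCA.
  congr (_ + _); rewrite [RHS]addrC mulr_suml -big_split/=.
  rewrite (eq_bigr (fun i => expR ((c k i + d k i * t) *+ be i))).
    rewrite -expR_sum expRK; apply: eq_bigr => i _.
    by rewrite mulrnDl mulrnAl.
  by move=> i _; rewrite -mulr_natl expRM_natl -rE lnK ?posrE.
have A0 := abs_poly_gt0 supp (b k) r0.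
have le_max := le_bigmax 0 (fun be => M be * \prod_i r i ^+ be i).
have [A_0|[be Abe]] := bigmax_attained (fun be => M be * \prod_i r i ^+ be i).
  by move: A0; rewrite A_0 ltxx.
split=> [|q' /mapP[ga]].
  have Mbe : 0 < M be by move: A0; rewrite Abe pmulr_lgt0.
  exists (q be); last by rewrite -qE// -Abe.
  by rewrite map_f// mem_filter Mbe mem_enum.
rewrite mem_filter => /andP[Mga _] ->; rewrite -qE//.
by rewrite ler_ln ?posrE ?mulr_gt0.
Qed.

End NonZero.

End PiecewisePolynomials.

Theorem corollary39 (R : realType) (K Khat : fieldType)
    (v : K -> \bar R) (vhat : Khat -> \bar R) (iota : {rmorphism K -> Khat})
    (hv : nontrivial_valuation v)
    (hK : valuation_complete v)
    (hKhat : completed_algebraic_closure v vhat iota)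
    (n : nat) (p : R) (hp : 1 < p)
    (f : {ffun 'I_n -> nat} -> set Khat)
    (hf : polynomial_over_B vhat iota f) :
  ((forall B, Bn vhat iota B ->
      abs_poly vhat f B \is a fin_num /\ (0 <= abs_poly vhat f B)%E) /\
   (forall (I : set R) (gamma : R -> set ('I_n -> Khat)),
      geodesic (@Bn R K Khat vhat iota n) (dBp vhat iota p) I gamma ->
      finite_piecewise_polynomial I
        (fun t => fine (abs_poly vhat f (gamma t))))) /\
  (nonzero_polynomial vhat iota f ->
   (forall B, Hn vhat iota B -> val_poly vhat f B \is a fin_num) /\
   (forall (I : set R) (gamma : R -> set ('I_n -> Khat)),
      geodesic (@Hn R K Khat vhat iota n) (dHp vhat iota p) I gamma ->
      finite_piecewise_linear I
        (fun t => fine (val_poly vhat f (gamma t))))).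
Proof.
split=> [|f0]; split.
- by move=> B; apply: (abs_poly_fin_ge0 hv hKhat hf).
- by move=> I gamma; apply: (abs_poly_geodesic hv hK hKhat hp hf).
- by move=> B; apply: (val_poly_fin hv hKhat hf f0).
- by move=> I gamma; apply: (val_poly_geodesic hv hK hKhat hp hf f0).
Qed.
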